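(* Let $(p_n)$ be a sequence of positive integers with $p_n\to\infty$ and $p_n/n\to0$. Let $\widehat\tau_M$ be the maximum marginal likelihood estimator $$\widehat\tau_M=\operatorname*{argmax}_{\tau\in[1/n,1]}\ \prod_{i=1}^n\int_{-\infty}^\infty\varphi(Y_i-\theta)\,g_\tau(\theta)\,d\theta .$$ Then there exists a constant $C>0$ such that $$\inf_{\theta_0\in\ell_0[p_n]}P_{\theta_0}\Big(\widehat\tau_M\in\big[1/n,\;C\,\tau_n(p_n)\big]\Big)\to1\qquad(n\to\infty).$$
   Context: Model: under $P_{\theta_0}$, with $\theta_0=(\theta_{0,1},\dots,\theta_{0,n})\in\mathbb R^n$, one observes $Y^n=(Y_1,\dots,Y_n)$ with independent coordinates $Y_i\sim N(\theta_{0,i},1)$. The set of nearly black vectors is $\ell_0[p]=\{\theta\in\mathbb R^n:\ \#\{i:\theta_i\neq0\}\le p\}$. $\varphi$ is the standard normal density, and $\tau_n(p)=(p/n)\sqrt{\log(n/p)}$. The horseshoe prior with parameter $\tau>0$ makes $\theta_1,\dots,\theta_n$ i.i.d. with density $$g_\tau(\theta)=\int_0^\infty\varphi\Big(\frac{\theta}{\lambda\tau}\Big)\frac1{\lambda\tau}\,\frac{2}{\pi(1+\lambda^2)}\,d\lambda ,$$ i.e. $\theta_i\mid\lambda_i\sim N(0,\lambda_i^2\tau^2)$ with $\lambda_i$ standard half-Cauchy. *)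

(* Defs.v *)
From HB Require Import structures.
From mathcomp Require Import all_boot all_order all_algebra.
From mathcomp Require Import all_classical all_reals all_analysis.

Set Implicit Arguments.
Unset Strict Implicit.
Unset Printing Implicit Defensive.

Import Order.TTheory GRing.Theory Num.Theory.
Import numFieldNormedType.Exports.

Local Open Scope classical_set_scope.
Local Open Scope ring_scope.

Section normal_means.
Context {R : realType}.

(* [normal_prob] is a measure on [measurableTypeR R], which carries the Borel
   sets of R under another display than R itself. *)
Definition tuple_cons (n : nat) (z : measurableTypeR R * n.-tuple R) :
  n.+1.-tuple R :=
  [tuple of (z.1 : R) :: z.2].

Lemma measurable_tuple_cons (n : nat) :
  measurable_fun [set: measurableTypeR R * n.-tuple R] (@tuple_cons n).
Proof.
apply: (@measurable_cons _ _ _ R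
  (fun z : measurableTypeR R * n.-tuple R => z.1) n snd).
- exact: measurable_fst.
- exact: measurable_snd.
Qed.

HB.instance Definition _ (n : nat) :=
  isMeasurableFun.Build _ _ _ _ (@tuple_cons n) (@measurable_tuple_cons n).

(* The law on R^n of independent coordinates Y_i ~ N(theta_i, 1), as the
   iterated product of the measures [normal_prob (theta_i) 1]. *)
Fixpoint normal_means (n : nat) : n.-tuple R -> probability (n.-tuple R) R :=
  match n with
  | 0 => fun=> dirac [tuple]
  | m.+1 => fun theta =>
      distribution (normal_prob (thead theta) 1 \x
                    normal_means ([tuple of behead theta] : m.-tuple R))%E
                   (@tuple_cons m)
  end.

Lemma normal_meansE (n : nat) (theta : n.-tuple R) (A : 'I_n -> set R) :
  (forall i, measurable (A i)) ->
  normal_means theta [set y | forall i, A i (tnth y i)] =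
  (\prod_(i < n) normal_prob (tnth theta i) 1 (A i))%E.
Proof.
elim: n theta A => [|n IHn] theta A mA.
  by rewrite big_ord0 /= diracE mem_set//= => -[].
rewrite /= /distribution /pushforward.
pose B (i : 'I_n) := A (lift ord0 i).
have -> : @tuple_cons n @^-1` [set y | forall i, A i (tnth y i)] =
    A ord0 `*` [set y | forall i, B i (tnth y i)].
  apply/seteqP; split => -[z y] /=.
    move=> Azy; split; first by have := Azy ord0; rewrite tnth0.
    by move=> i; have := Azy (lift ord0 i); rewrite tnthS.
  move=> [Az Ay] i; case: (unliftP ord0 i) => [j|] ->.
    by rewrite tnthS; exact: Ay.
  by rewrite tnth0.
have mB : measurable [set y : n.-tuple R | forall i, B i (tnth y i)].
  rewrite (_ : mkset _ =
      \bigcap_(i in [set: 'I_n]) ((@tnth n R)^~ i @^-1` B i)).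
    apply: fin_bigcap_measurable => [|i _]; first exact: finite_finset.
    by rewrite -[X in measurable X]setTI; apply: measurable_tnth => //; exact: mA.
  by apply/seteqP; split => y /= yB i => [_|]; exact: yB.
rewrite [LHS]product_measure1E//; last exact: mA.
rewrite big_ord_recl; congr (_ * _)%E.
rewrite [LHS]IHn => [|i]; last exact: mA.
apply: eq_bigr => i _; congr (normal_prob _ _ _).
by rewrite tnth_behead; congr tnth; apply: val_inj => /=; rewrite inordK ?ltnS.
Qed.

(* Extended-real valued: for 0 < tau the integral is finite except at x = 0,
   where it diverges. *)
Definition horseshoe_density (tau x : R) : \bar R :=
  (\int[lebesgue_measure]_(l in `]0%R, +oo[)
     (normal_pdf 0 1 (x / (l * tau)) * (l * tau)^-1 *
      (2 / (pi * (1 + l ^+ 2))))%:E)%E.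

Definition marginal_likelihood (n : nat) (y : n.-tuple R) (tau : R) : \bar R :=
  (\prod_(i < n) \int[lebesgue_measure]_x
     ((normal_pdf 0 1 (tnth y i - x))%:E * horseshoe_density tau x))%E.

Definition is_mmle (n : nat) (y : n.-tuple R) (t : R) : Prop :=
  t \in `[n%:R^-1, 1] /\
  (forall s : R, s \in `[n%:R^-1, 1] ->
     (marginal_likelihood y s <= marginal_likelihood y t)%E).

Definition nearly_black (n p : nat) : set (n.-tuple R) :=
  [set theta | (#|[pred i : 'I_n | tnth theta i != 0%R]| <= p)%N].

Definition tau_rate (n p : nat) : R :=
  p%:R / n%:R * Num.sqrt (ln (n%:R / p%:R)).

End normal_means.

Arguments nearly_black R n p : clear implicits.
Arguments tau_rate R n p : clear implicits.

(* Main.v *)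
(** Put [f_t y] for the ratio at [y] of the horseshoe marginal density with
    parameter [t] and the N(0, 1) density ([mix_ratio]); the estimator maximizes
    the product of the [f_t (Y_i)].  Since the half-Cauchy densities satisfy
    [rho_t <= (t / s) rho_s] for [s <= t], each of the at most [p] nonzero means
    contributes at most [(t / s)^p] to the ratio of the likelihoods at [t] and
    [s], where [s] is the rate.

    For the zero means, [f_t <= 1 + (t / s) (f_s - 1) + t^2], hence
    [f_t / f_s <= exp ((t / s - 1) W + 2 t^2)] with [W = 1 - 1 / f_s].  The
    main term is affine in [t], so one event controls all small [t] at once.  As
    [E f_s = 1], the mean of [W] under N(0, 1) is minus the chi-square type
    divergence [E ((f_s - 1)^2 / f_s)], which is at least of the order
    [s / sqrt (ln (1 / s))], that is, of order [p / n]; a Chernoff bound makes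
    the sum of the [W (Y_i)] at most [- c p] except with probability [exp (- c p)].

    The error [t^2] is harmless as long as [t <= c / sqrt (ln (n / p))].  For
    larger [t], the Hellinger affinity [E sqrt f_t <= 1 - c t^2] and a union bound
    over a grid of mesh [n^-2] suffice. *)

Require Import Defs.
From mathcomp Require Import all_boot all_order all_algebra.
From mathcomp Require Import all_classical all_reals all_analysis.
From mathcomp Require Import measurable_realfun ring lra.

Import Order.TTheory GRing.Theory Num.Theory.
Import numFieldNormedType.Exports.

Local Open Scope classical_set_scope.
Local Open Scope ring_scope.

(** * The Gaussian and Cauchy kernels *)

Section kernels.
Context {R : realType}.
Implicit Types s t u y : R.

(* The ratio at [y] of the densities of N(0, 1 + u^2) and N(0, 1). *)
Definition gauss_ratio y u : R :=
  (Num.sqrt (1 + u ^+ 2))^-1 * expR (y ^+ 2 / 2 * (u ^+ 2 / (1 + u ^+ 2))).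

(** The law of [u = lambda * t] for [lambda] standard half-Cauchy. Working with [u] confines the
    dependence on [t] to this factor, which makes different parameters comparable. *)
Definition half_cauchy t u : R := 2 * t / (pi * (t ^+ 2 + u ^+ 2)).

Lemma oneDsqr_gt0 u : 0 < 1 + u ^+ 2.
Proof. by rewrite ltr_pwDl// sqr_ge0. Qed.

Lemma sqrt_oneDsqr_ge1 u : 1 <= Num.sqrt (1 + u ^+ 2).
Proof.
by rewrite -[leLHS](@sqrtr1 R) ler_wsqrtr// lerDl sqr_ge0.
Qed.

Lemma gauss_ratio_gt0 y u : 0 < gauss_ratio y u.
Proof.
by rewrite mulr_gt0 ?expR_gt0// invr_gt0 sqrtr_gt0 oneDsqr_gt0.
Qed.

Lemma gauss_ratio_ge0 y u : 0 <= gauss_ratio y u.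
Proof. exact/ltW/gauss_ratio_gt0. Qed.

Lemma half_cauchy_ge0 t u : 0 <= t -> 0 <= half_cauchy t u.
Proof.
by move=> t0; rewrite divr_ge0 ?mulr_ge0 ?pi_ge0// addr_ge0 ?sqr_ge0.
Qed.

Lemma sqr_oneDsqr_ge0 u : 0 <= u ^+ 2 / (1 + u ^+ 2).
Proof. by rewrite divr_ge0 ?sqr_ge0// ltW// oneDsqr_gt0. Qed.

Lemma sqr_oneDsqr_lt1 u : u ^+ 2 / (1 + u ^+ 2) < 1.
Proof. by rewrite ltr_pdivrMr ?oneDsqr_gt0// mul1r ltrDr. Qed.

Lemma gauss_ratio_ge y u : (1 + u ^+ 2)^-1 <= gauss_ratio y u.
Proof.
have u1 := oneDsqr_gt0 u.
rewrite -[leLHS]mulr1 ler_pM ?invr_ge0 ?(ltW u1)//.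
  rewrite lef_pV2 ?posrE ?sqrtr_gt0//.
  rewrite -{2}(sqr_sqrtr (ltW u1)) ler_eXnr//.
  exact: sqrt_oneDsqr_ge1.
apply: le_trans (expR_ge1Dx _).
by rewrite lerDl mulr_ge0 ?sqr_oneDsqr_ge0// divr_ge0 ?sqr_ge0.
Qed.

Lemma gauss_ratio_le y u : gauss_ratio y u <= expR (y ^+ 2 / 2).
Proof.
rewrite -[leRHS]mul1r ler_pM ?expR_ge0 ?invr_ge0 ?sqrtr_ge0//.
  rewrite invf_le1 ?sqrtr_gt0 ?oneDsqr_gt0//.
  exact: sqrt_oneDsqr_ge1.
by rewrite ler_expR ler_piMr ?(ltW (sqr_oneDsqr_lt1 u))// divr_ge0 ?sqr_ge0.
Qed.

Lemma sqr_gauss_ratio_le y u : y ^+ 2 <= 1 ->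
  gauss_ratio y u ^+ 2 <= expR (u ^+ 2 / (1 + u ^+ 2)) / (1 + u ^+ 2).
Proof.
move=> y1; rewrite exprMn exprVn sqr_sqrtr ?(ltW (oneDsqr_gt0 u))// mulrC.
rewrite ler_wpM2r ?invr_ge0 ?(ltW (oneDsqr_gt0 u))//.
rewrite -expRM_natl ler_expR mulrA.
rewrite -[leRHS]mul1r ler_wpM2r ?sqr_oneDsqr_ge0//; lra.
Qed.

(** With [v = u^2 / (1 + u^2)], the square is at most [(1 - v) exp v], and [1 - v <= exp (- v)]. *)
Lemma gauss_ratio_le1 y u : y ^+ 2 <= 1 -> gauss_ratio y u <= 1.
Proof.
move=> /(sqr_gauss_ratio_le y u) h.
rewrite -(@ler_pXn2r _ 2) ?nnegrE ?gauss_ratio_ge0//.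
rewrite expr1n (le_trans h)// ler_pdivrMr ?oneDsqr_gt0// mul1r.
rewrite -[leRHS]invrK -[leLHS]invrK -expRN.
have u1 := oneDsqr_gt0 u.
rewrite lef_pV2 ?posrE ?invr_gt0 ?expR_gt0//.
apply: le_trans (expR_ge1Dx _).
by rewrite le_eqVlt; apply/orP; left; apply/eqP; field; rewrite lt0r_neq0.
Qed.

Lemma expR1_le4 : expR 1 <= 4 :> R.
Proof.
have : expR (- (1 / 2)) >= 1 / 2 :> R by apply: le_trans (expR_ge1Dx _); lra.
have e0 := expR_gt0 (1 / 2 : R).
rewrite expRN -[leRHS]mul1r ler_pdivlMr// => e2.
have -> : 1 = 2 * (1 / 2) :> R by lra.
by rewrite expRM_natl; nra.
Qed.

Lemma gauss_ratio_le_half y u : y ^+ 2 <= 1 -> 4 <= u -> gauss_ratio y u <= 1 / 2.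
Proof.
move=> /(sqr_gauss_ratio_le y u) h u4.
have g0 := gauss_ratio_ge0 y u.
have u1 := oneDsqr_gt0 u.
rewrite -(@ler_pXn2r _ 2) ?nnegrE ?gauss_ratio_ge0 ?divr_ge0//.
rewrite (le_trans h)// ler_pdivrMr//.
have : expR (u ^+ 2 / (1 + u ^+ 2)) <= expR 1.
  by rewrite ler_expR ltW// sqr_oneDsqr_lt1.
have := expR1_le4; nra.
Qed.

(** A scale [u] between [y] and [2 y] captures the exponent [y^2 / 2] up to [1 / 2], at the price of
    a prefactor [sqrt (1 + u^2) <= 3 y]. *)
Lemma gauss_ratio_ge_tail y u : 1 <= y -> y <= u -> u <= 2 * y ->
  expR (y ^+ 2 / 2) / (6 * y) <= gauss_ratio y u.
Proof.
move=> y1 yu u2y; have u1 := oneDsqr_gt0 u.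
have y0 : 0 < y by lra.
have -> : expR (y ^+ 2 / 2) / (6 * y) = (3 * y)^-1 * (expR (y ^+ 2 / 2) / 2).
  by field; lra.
rewrite ler_pM ?invr_ge0 ?divr_ge0 ?expR_ge0 ?mulr_ge0 ?(ltW y0)//.
  rewrite lef_pV2 ?posrE ?sqrtr_gt0 ?mulr_gt0//.
  rewrite -[leRHS]ger0_norm ?mulr_ge0 ?(ltW y0)// -sqrtr_sqr ler_sqrt.
    by nra.
  exact: sqr_ge0.
have -> : y ^+ 2 / 2 * (u ^+ 2 / (1 + u ^+ 2)) =
    y ^+ 2 / 2 - (y ^+ 2 / (1 + u ^+ 2)) / 2 by field; lra.
rewrite expRD ler_wpM2l ?expR_ge0//.
apply: le_trans (expR_ge1Dx _).
have : y ^+ 2 / (1 + u ^+ 2) <= 1 by rewrite ler_pdivrMr//; nra.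
lra.
Qed.

Lemma pi_le4 : pi <= 4 :> R.
Proof. by have /andP[_] := pihalf_02 R; lra. Qed.

Lemma half_cauchyE t u : 0 < t -> half_cauchy t u = (2 / pi) * (t / (t ^+ 2 + u ^+ 2)).
Proof.
move=> t0; rewrite /half_cauchy; have := pi_gt0 R => p0.
have : 0 < t ^+ 2 + u ^+ 2 by rewrite ltr_pwDl ?sqr_ge0// exprn_gt0.
by move=> tu; field; lra.
Qed.

Lemma half_cauchy_le s t u : 0 < s -> s <= t ->
  half_cauchy t u <= t / s * half_cauchy s u.
Proof.
move=> s0 st; have t0 : 0 < t by lra.
rewrite !half_cauchyE// [leRHS]mulrCA ler_wpM2l ?divr_ge0 ?pi_ge0//.
rewrite mulrA (divfK (lt0r_neq0 s0)) ler_wpM2l ?(ltW t0)//.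
rewrite lef_pV2 ?posrE ?ltr_pwDl ?sqr_ge0 ?exprn_gt0// lerD2r.
by rewrite ler_pXn2r// nnegrE ltW.
Qed.

Lemma half_cauchy_ge_itv45 t u : 0 < t -> t <= 2 -> 4 <= u <= 5 ->
  t / 58 <= half_cauchy t u.
Proof.
move=> t0 t2 /andP[u4 u5]; rewrite half_cauchyE//.
have tu : 0 < t ^+ 2 + u ^+ 2 by rewrite ltr_pwDl ?sqr_ge0// exprn_gt0.
have -> : t / 58 = (1 / 2) * (t / 29) by lra.
rewrite ler_pM ?divr_ge0 ?(ltW t0)//.
  by rewrite ler_pdivlMr ?pi_gt0//; have := pi_le4; lra.
rewrite ler_wpM2l ?(ltW t0)// lef_pV2 ?posrE//; nra.
Qed.

Lemma half_cauchy_ge_tail t y u : 0 < t -> t <= 1 -> 1 <= y -> y <= u -> u <= 2 * y ->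
  t / (10 * y ^+ 2) <= half_cauchy t u.
Proof.
move=> t0 t1 y1 yu u2y; rewrite half_cauchyE//.
have tu : 0 < t ^+ 2 + u ^+ 2 by rewrite ltr_pwDl ?sqr_ge0// exprn_gt0.
have y0 : 0 < y by lra.
have -> : t / (10 * y ^+ 2) = (1 / 2) * (t / (5 * y ^+ 2)) by field; lra.
rewrite ler_pM ?divr_ge0 ?mulr_ge0 ?(ltW y0) ?(ltW t0)//.
  by rewrite ler_pdivlMr ?pi_gt0//; have := pi_le4; lra.
rewrite ler_wpM2l ?(ltW t0)// lef_pV2 ?posrE//; nra.
Qed.

(* [gauss_ratio y u >= 1 - u^2 / (1 + u^2)], and the factor [u^2] absorbs the
   singularity at [0] of the two Cauchy kernels. *)
Lemma gauss_ratio_half_cauchy_deficit y t u : 0 < t ->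
  half_cauchy t u <= gauss_ratio y u * half_cauchy t u + t * half_cauchy 1 u.
Proof.
move=> t0; have u1 := oneDsqr_gt0 u.
have tu : 0 < t ^+ 2 + u ^+ 2 by rewrite ltr_pwDl ?sqr_ge0// exprn_gt0.
have h0 := half_cauchy_ge0 t u (ltW t0).
have ge : (1 + u ^+ 2)^-1 * half_cauchy t u <= gauss_ratio y u * half_cauchy t u.
  by rewrite ler_wpM2r// gauss_ratio_ge.
apply: le_trans (lerD ge (lexx _)).
rewrite -lerBlDl !half_cauchyE// expr1n.
have -> : t * (2 / pi * (1 / (1 + u ^+ 2))) = (2 / pi) * (t / (1 + u ^+ 2)).
  by ring.
have -> : 2 / pi * (t / (t ^+ 2 + u ^+ 2)) -
    (1 + u ^+ 2)^-1 * (2 / pi * (t / (t ^+ 2 + u ^+ 2))) =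
    2 / pi * (t / (1 + u ^+ 2) * (u ^+ 2 / (t ^+ 2 + u ^+ 2))).
  by have p0 := pi_gt0 R; field; lra.
rewrite ler_wpM2l ?divr_ge0 ?pi_ge0// ler_piMr ?divr_ge0 ?(ltW t0) ?(ltW u1)//.
by rewrite ler_pdivrMr// mul1r lerDr sqr_ge0.
Qed.

(** Pointwise form of the affine bound on [f_t], arranged so that all terms are nonnegative and can
    be integrated. With [k = (t / s) rho_s] and [h = rho_t] it reads [(1 - a) (k - h) <= t^2 h];
    here [1 - a <= u^2 / (1 + u^2)] and [k - h = h (t^2 - s^2) / (s^2 + u^2)], so [u^2] cancels the
    singular denominator. *)
Lemma gauss_ratio_half_cauchy_affine y s t u : 0 < s -> s <= t ->
  gauss_ratio y u * half_cauchy t u + t / s * half_cauchy s u <=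
  (1 + t ^+ 2) * half_cauchy t u + t / s * (gauss_ratio y u * half_cauchy s u).
Proof.
move=> s0 st; have t0 : 0 < t by lra.
have u1 := oneDsqr_gt0 u.
have ht0 := half_cauchy_ge0 t u (ltW t0).
set k := t / s * half_cauchy s u; set h := half_cauchy t u in ht0 *.
set a := gauss_ratio y u.
have hk : h <= k by exact: half_cauchy_le.
have -> : t / s * (a * half_cauchy s u) = a * k by rewrite /k; ring.
suff : (1 - a) * (k - h) <= t ^+ 2 * h by nra.
have a1 : 1 - a <= u ^+ 2 / (1 + u ^+ 2).
  rewrite lerBlDr -lerBlDl; apply: le_trans (gauss_ratio_ge y u).
  by rewrite le_eqVlt; apply/orP; left; apply/eqP; field; lra.
have : (1 - a) * (k - h) <= u ^+ 2 / (1 + u ^+ 2) * (k - h).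
  by rewrite ler_wpM2r// subr_ge0.
move=> /le_trans; apply.
have su : 0 < s ^+ 2 + u ^+ 2 by rewrite ltr_pwDl ?sqr_ge0// exprn_gt0.
have kE : k - h = (2 / pi * (t / (t ^+ 2 + u ^+ 2))) *
    ((t ^+ 2 - s ^+ 2) / (s ^+ 2 + u ^+ 2)).
  have p0 := pi_gt0 R.
  have tu : 0 < t ^+ 2 + u ^+ 2 by rewrite ltr_pwDl ?sqr_ge0// exprn_gt0.
  rewrite /k /h !half_cauchyE//; field; lra.
rewrite kE -half_cauchyE// -/h mulrCA mulrC ler_wpM2r//.
rewrite mulf_div ler_pdivrMr ?mulr_gt0//.
have : 0 <= s ^+ 2 by exact: sqr_ge0.
have : 0 <= u ^+ 2 by exact: sqr_ge0.
have : 0 <= t ^+ 2 by exact: sqr_ge0.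
move: (s ^+ 2) (u ^+ 2) (t ^+ 2) => S U T T0 U0 S0.
rewrite -subr_ge0.
have -> : T * ((1 + U) * (S + U)) - U * (T - S) = T * S + T * U * S + T * U ^+ 2 + U * S.
  by ring.
by rewrite !addr_ge0 ?mulr_ge0 ?exprn_ge0.
Qed.

End kernels.

(** * Measurability, continuity and normalization of the kernels *)

Section mixture_ratio.
Context {R : realType}.
Implicit Types s t u y : R.
Notation mu := (@lebesgue_measure R).
Notation halfline := `[0%R, +oo[%classic.

Lemma measurable_invr : measurable_fun setT (@GRing.inv R).
Proof.
(* Squaring gives the real power a nonnegative base; at [0] both sides vanish, the inverse of [0]
   being [0]. *)
have -> : @GRing.inv R = fun x => x * (x ^+ 2) `^ (-1).
  apply/funext => x; rewrite powR_inv1 ?sqr_ge0//.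
  have [->|x0] := eqVneq x 0; first by rewrite invr0 mul0r.
  by rewrite expr2 invfM mulrA divff// mul1r.
apply: measurable_funM => //.
by apply: (measurableT_comp (measurable_powR (-1))).
Qed.

Lemma measurable_funV d (T : measurableType d) (f : T -> R) :
  measurable_fun setT f -> measurable_fun setT (fun x => (f x)^-1).
Proof. exact: measurableT_comp measurable_invr. Qed.

Lemma measurable_sqrt : measurable_fun setT (@Num.sqrt R).
Proof. by apply: continuous_measurable_fun => x; exact: sqrt_continuous. Qed.

Lemma measurable_gauss_ratio_pair :
  measurable_fun setT (fun z : R * R => gauss_ratio z.1 z.2).
Proof.
have m1 : measurable_fun setT (fun z : R * R => 1 + z.2 ^+ 2).
  by apply: measurable_funD => //; exact: measurable_funX.
apply: measurable_funM.
  by apply: measurable_funV; exact: (measurableT_comp measurable_sqrt).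
apply: (measurableT_comp (@measurable_expR R)).
apply: measurable_funM; last first.
  by apply: measurable_funM; [exact: measurable_funX | exact: measurable_funV].
by apply: measurable_funM => //; exact: measurable_funX.
Qed.

Lemma measurable_half_cauchy t : measurable_fun setT (half_cauchy t).
Proof.
apply: measurable_funM => //; apply: measurable_funV.
by apply: measurable_funM => //; exact: measurable_funD.
Qed.

Lemma continuous_oneDsqr_scaled (c : R) : continuous (fun u : R => c + u ^+ 2).
Proof.
move=> x; apply: cvgD; first exact: cvg_cst.
exact: sqr_continuous.
Qed.

Lemma continuous_gauss_ratio y : continuous (gauss_ratio y).
Proof.
move=> x; have x1 := oneDsqr_gt0 x.
have c1 : {for x, continuous (fun u : R => 1 + u ^+ 2)}.
  exact: continuous_oneDsqr_scaled.
apply: cvgM.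
  apply: cvgV; first by rewrite gt_eqF// sqrtr_gt0.
  exact: (continuous_comp c1 (@sqrt_continuous R _)).
apply: (cvg_comp _ expR); last exact: continuous_expR.
apply: cvgM; first exact: cvg_cst.
apply: cvgM; first exact: sqr_continuous.
by apply: cvgV => //; rewrite gt_eqF.
Qed.

Lemma measurable_gauss_ratio y : measurable_fun setT (gauss_ratio y).
Proof. by apply: continuous_measurable_fun; exact: continuous_gauss_ratio. Qed.

Lemma continuous_half_cauchy t : 0 < t -> continuous (half_cauchy t).
Proof.
move=> t0 x; apply: cvgM; first exact: cvg_cst.
apply: cvgV.
  rewrite gt_eqF// mulr_gt0 ?pi_gt0// ltr_pwDl ?sqr_ge0//.
  exact: exprn_gt0.
apply: cvgM; first exact: cvg_cst.
exact: continuous_oneDsqr_scaled.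
Qed.

Lemma ge0_integral_scale (G : R -> R) t : 0 < t -> continuous G ->
  (forall x, 0 <= G x) ->
  (\int[mu]_(u in halfline) (G u)%:E =
   \int[mu]_(l in halfline) (G (l * t) * t)%:E)%E.
Proof.
move=> t0 cG G0.
pose F (l : R) : R := l * t.
have F'E : F^`()%classic = cst t.
  apply/funext => x; rewrite /F derive1E deriveM// derive_id derive_cst.
  by rewrite scaler0 add0r /GRing.scale/= mulr1.
have := @increasing_ge0_integration_by_substitutiony R F G 0.
have F0 : F 0 = 0 by rewrite /F mul0r.
rewrite F'E F0 => -> //.
- by move=> x y _ _ xy; rewrite /F ltr_pM2r.
- by move=> x _; exact: cvg_cst.
- exact: is_cvg_cst.
- exact: is_cvg_cst.
- split; first by move=> x _; apply: derivableM.
  apply: cvg_at_right_filter; apply: cvgM; first exact: cvg_id.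
  exact: cvg_cst.
- by apply: gt0_cvgMly => //; exact: cvg_id.
- by apply: continuous_subspaceT.
Qed.

Lemma integral_half_cauchy t : 0 < t ->
  (\int[mu]_(u in halfline) (half_cauchy t u)%:E = 1)%E.
Proof.
move=> t0; rewrite (@ge0_integral_scale _ t)//; last 2 first.
- exact: continuous_half_cauchy.
- by move=> x; exact/half_cauchy_ge0/ltW.
transitivity (\int[mu]_(x in halfline) ((2 / pi)%:E * (oneDsqr x)^-1%:E))%E.
  apply: eq_integral => x _; rewrite -EFinM half_cauchyE//; congr EFin.
  have p0 := pi_gt0 R; have x1 := oneDsqr_gt0 x.
  rewrite /oneDsqr (_ : t ^+ 2 + (x * t) ^+ 2 = t ^+ 2 * (1 + x ^+ 2)); last by ring.
  by field; lra.
rewrite ge0_integralZl_EFin//.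
- rewrite integral0y_oneDsqr -EFinM; congr EFin.
  by have p0 := pi_gt0 R; field; lra.
- apply/measurable_EFinP/measurable_funTS; apply: measurable_funV.
  by apply: measurable_funD => //; exact: measurable_funX.
- by rewrite divr_ge0// pi_ge0.
Qed.

End mixture_ratio.

(** * The density ratio of the horseshoe marginal *)

Section ge0_real_integral.
Context {R : realType}.
Implicit Types (D : set R) (g h : R -> R) (a I J : R).
Notation mu := (@lebesgue_measure R).

(** Nonnegativity, measurability and a finite real value are bundled so that comparing integrals
    becomes an inequality between real numbers. *)
Definition has_integral D g I :=
  [/\ measurable_fun setT g, forall x, 0 <= g x &
      (\int[mu]_(x in D) (g x)%:E = I%:E)%E].

Lemma has_integralD D g h I J : measurable D ->
  has_integral D g I -> has_integral D h J ->
  has_integral D (fun x => g x + h x) (I + J).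
Proof.
move=> mD [mg g0 gI] [mh h0 hJ]; split.
- exact: measurable_funD.
- by move=> x; rewrite addr_ge0.
- rewrite EFinD -gI -hJ -ge0_integralD//.
  + by move=> x _; rewrite lee_fin.
  + exact/measurable_EFinP/measurable_funTS.
  + by move=> x _; rewrite lee_fin.
  + exact/measurable_EFinP/measurable_funTS.
Qed.

Lemma has_integralZ D a g I : measurable D -> 0 <= a ->
  has_integral D g I -> has_integral D (fun x => a * g x) (a * I).
Proof.
move=> mD a0 [mg g0 gI]; split.
- exact: measurable_funM.
- by move=> x; rewrite mulr_ge0.
- rewrite EFinM -gI -ge0_integralZl_EFin//.
  + by move=> x _; rewrite lee_fin.
  + exact/measurable_EFinP/measurable_funTS.
Qed.

Lemma has_integral_ge0 D g I : has_integral D g I -> 0 <= I.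
Proof.
move=> [_ g0 gI]; rewrite -lee_fin -gI.
by apply: integral_ge0 => x _; rewrite lee_fin.
Qed.

Lemma has_integral_le D g h I J : measurable D ->
  has_integral D g I -> has_integral D h J ->
  (forall x, D x -> g x <= h x) -> I <= J.
Proof.
move=> mD [mg g0 gI] [mh h0 hJ] gh; rewrite -lee_fin -gI -hJ.
apply: ge0_le_integral => //.
- by move=> x _; rewrite lee_fin.
- exact/measurable_EFinP/measurable_funTS.
- exact/measurable_EFinP/measurable_funTS.
Qed.

Lemma has_integral_dominated D g h J : measurable D ->
  measurable_fun setT g -> (forall x, 0 <= g x) -> has_integral D h J ->
  (forall x, D x -> g x <= h x) ->
  has_integral D g (fine (\int[mu]_(x in D) (g x)%:E)).
Proof.
move=> mD mg g0 [mh h0 hJ] gh; split => //.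
rewrite fineK// ge0_fin_numE; last first.
  by apply: integral_ge0 => x _; rewrite lee_fin.
apply: (@le_lt_trans _ _ J%:E); last exact: ltry.
rewrite -hJ; apply: ge0_le_integral => //.
- by move=> x _; rewrite lee_fin.
- exact/measurable_EFinP/measurable_funTS.
- exact/measurable_EFinP/measurable_funTS.
Qed.

Lemma has_integral_itv D a I : measurable D -> a <= I -> `[a, I] `<=` D ->
  has_integral D \1_`[a, I] (I - a).
Proof.
move=> mD aI sD; split.
- exact: measurable_indic.
- by move=> x; rewrite indicE.
- rewrite integral_indic//=; rewrite setIidl//.
  rewrite lebesgue_measure_itv/= lte_fin; case: ltP => //.
  by move=> Ia; have -> : I = a by [apply/eqP; rewrite eq_le aI Ia]; rewrite subrr.
Qed.

End ge0_real_integral.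

Arguments has_integralD {R D g h I J}.
Arguments has_integralZ {R D a g I}.
Arguments has_integral_ge0 {R D g I}.
Arguments has_integral_le {R D g h I J}.
Arguments has_integral_itv {R D a I}.

(** * Pointwise bounds on the density ratio *)

Section mix_ratio.
Context {R : realType}.
Implicit Types s t u y : R.
Notation mu := (@lebesgue_measure R).
Notation halfline := (`[0%R, +oo[%classic : set R).

(* The ratio at [y] of the horseshoe marginal density and the N(0, 1) density. *)
Definition mix_ratio t y : R :=
  fine (\int[mu]_(u in halfline) (gauss_ratio y u * half_cauchy t u)%:E)%E.

Lemma has_integral_half_cauchy t : 0 < t ->
  has_integral halfline (half_cauchy t) 1.
Proof.
move=> t0; split; [exact: measurable_half_cauchy | | exact: integral_half_cauchy].
by move=> x; exact/half_cauchy_ge0/ltW.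
Qed.

(** For fixed [y] the Gaussian ratio is bounded in [u] by [exp (y^2 / 2)]; the integral is therefore
    finite and [fine] loses nothing. *)
Lemma has_integral_mix_ratio t y : 0 < t ->
  has_integral halfline (fun u => gauss_ratio y u * half_cauchy t u) (mix_ratio t y).
Proof.
move=> t0; apply: (@has_integral_dominated _ _ _
    (fun u => expR (y ^+ 2 / 2) * half_cauchy t u) (expR (y ^+ 2 / 2) * 1)) => //.
- by apply: measurable_funM; [exact: measurable_gauss_ratio | exact: measurable_half_cauchy].
- by move=> u; rewrite mulr_ge0 ?gauss_ratio_ge0 ?half_cauchy_ge0 ?(ltW t0).
- by apply: has_integralZ => //; exact: has_integral_half_cauchy.
- by move=> u _; rewrite ler_wpM2r ?half_cauchy_ge0 ?(ltW t0)// gauss_ratio_le.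
Qed.

Lemma mix_ratio_ge0 t y : 0 < t -> 0 <= mix_ratio t y.
Proof. by move=> t0; exact: has_integral_ge0 (has_integral_mix_ratio t y t0). Qed.

Lemma mix_ratio_le_scale s t y : 0 < s -> s <= t ->
  mix_ratio t y <= t / s * mix_ratio s y.
Proof.
move=> s0 st; have t0 : 0 < t by lra.
have ts0 : 0 <= t / s by rewrite divr_ge0 ?(ltW s0) ?(ltW t0).
apply: (has_integral_le _ (has_integral_mix_ratio t y t0)
  (has_integralZ _ ts0 (has_integral_mix_ratio s y s0))) => // u _.
by rewrite [leRHS]mulrCA ler_wpM2l ?gauss_ratio_ge0// half_cauchy_le.
Qed.

Lemma mix_ratio_le_affine s t y : 0 < s -> s <= t ->
  mix_ratio t y <= 1 + t / s * (mix_ratio s y - 1) + t ^+ 2.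
Proof.
move=> s0 st; have t0 : 0 < t by lra.
have ts0 : 0 <= t / s by rewrite divr_ge0 ?(ltW s0) ?(ltW t0).
have t20 : 0 <= 1 + t ^+ 2 by rewrite ltW// oneDsqr_gt0.
have mD : measurable halfline by [].
have := has_integral_le mD
  (has_integralD mD (has_integral_mix_ratio t y t0)
     (has_integralZ mD ts0 (has_integral_half_cauchy s s0)))
  (has_integralD mD (has_integralZ mD t20 (has_integral_half_cauchy t t0))
     (has_integralZ mD ts0 (has_integral_mix_ratio s y s0))).
move=> /(_ (fun u _ => gauss_ratio_half_cauchy_affine y s t u s0 st)); lra.
Qed.

Lemma mix_ratio_ge t y : 0 < t -> 1 - t <= mix_ratio t y.
Proof.
move=> t0; have mD : measurable halfline by [].
have := has_integral_le mD (has_integral_half_cauchy t t0)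
  (has_integralD mD (has_integral_mix_ratio t y t0)
     (has_integralZ mD (ltW t0) (has_integral_half_cauchy 1 ltr01))).
move=> /(_ (fun u _ => gauss_ratio_half_cauchy_deficit y t u t0)); lra.
Qed.

(** For [|y| <= 1] no scale raises the density, and scales in [[4, 5]], of prior mass at least
    [t / 58], lose at least half of it. *)
Lemma mix_ratio_le_center t y : y ^+ 2 <= 1 -> 0 < t -> t <= 2 ->
  mix_ratio t y <= 1 - t / 116.
Proof.
move=> y1 t0 t2; have mD : measurable halfline by [].
have c0 : 0 <= t / 116 by lra.
have sD : `[4, 5 : R] `<=` halfline.
  by move=> x /=; rewrite !in_itv/= => /andP[]; lra.
have le45 : 4 <= 5 :> R by lra.
have := has_integral_le mD
  (has_integralD mD (has_integral_mix_ratio t y t0)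
     (has_integralZ mD c0 (has_integral_itv mD le45 sD)))
  (has_integral_half_cauchy t t0).
suff h u : halfline u -> gauss_ratio y u * half_cauchy t u +
    t / 116 * \1_`[4, 5] u <= half_cauchy t u by move=> /(_ h); lra.
move=> _; have h0 := half_cauchy_ge0 t u (ltW t0).
rewrite indicE; case: (boolP (u \in _)); rewrite ?inE/= ?in_itv/= => u45.
  have := half_cauchy_ge_itv45 t u t0 t2 u45.
  have /andP[u4 _] := u45.
  have := gauss_ratio_le_half y u y1 u4; nra.
by rewrite mulr0 addr0 ler_piMl// gauss_ratio_le1.
Qed.

(** Keeps only the scales in [[y, 2 y]], an interval of length [y], and multiplies the two tail
    bounds. *)
Lemma mix_ratio_ge_tail t y : 0 < t -> t <= 1 -> 1 <= y ->
  t * expR (y ^+ 2 / 2) / (60 * y ^+ 2) <= mix_ratio t y.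
Proof.
move=> t0 t1 y1; have mD : measurable halfline by [].
have y0 : 0 < y by lra.
have e0 := expR_gt0 (y ^+ 2 / 2).
set c := expR (y ^+ 2 / 2) / (6 * y) * (t / (10 * y ^+ 2)).
have c0 : 0 <= c.
  by rewrite mulr_ge0 ?divr_ge0 ?mulr_ge0 ?exprn_ge0 ?(ltW y0) ?(ltW e0) ?(ltW t0).
have sD : `[y, 2 * y] `<=` halfline.
  by move=> x /=; rewrite !in_itv/= => /andP[]; lra.
have le2 : y <= 2 * y by lra.
have := has_integral_le mD
  (has_integralZ mD c0 (has_integral_itv mD le2 sD))
  (has_integral_mix_ratio t y t0).
have -> : c * (2 * y - y) = t * expR (y ^+ 2 / 2) / (60 * y ^+ 2).
  by rewrite /c; field; lra.
apply => u _.
rewrite indicE; case: (boolP (u \in _)); rewrite ?inE/= ?in_itv/= => uy.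
  have /andP[yu uy2] := uy.
  rewrite mulr1 ler_pM ?divr_ge0 ?mulr_ge0 ?exprn_ge0 ?(ltW y0) ?(ltW e0) ?(ltW t0)//.
    exact: gauss_ratio_ge_tail.
  exact: half_cauchy_ge_tail.
by rewrite mulr0 mulr_ge0 ?gauss_ratio_ge0 ?half_cauchy_ge0 ?(ltW t0).
Qed.

End mix_ratio.

(** * The horseshoe marginal as a Gaussian scale mixture *)

Section gaussian.
Context {R : realType}.
Implicit Types m s t u y : R.
Notation mu := (@lebesgue_measure R).
Notation halfline := (`[0%R, +oo[%classic : set R).
Notation phi := (normal_pdf 0 1).

Definition phi_peak : R := (Num.sqrt (pi *+ 2))^-1.

Lemma phi_peak_gt0 : 0 < phi_peak.
Proof. by rewrite invr_gt0 sqrtr_gt0 pmulrn_lgt0// pi_gt0. Qed.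

Lemma normal_pdf_gt0E m s x : 0 < s ->
  normal_pdf m s x = phi_peak / s * expR (- (x - m) ^+ 2 / (2 * s ^+ 2)).
Proof.
move=> s0; rewrite normal_pdfE ?gt_eqF// /normal_peak /normal_fun.
rewrite -mulrnAr sqrtrM ?sqr_ge0// sqrtr_sqr gtr0_norm// invfM (mulrC s^-1).
by rewrite mulr_natl.
Qed.

Lemma phiE y : phi y = phi_peak * expR (- y ^+ 2 / 2).
Proof. by rewrite normal_pdf_gt0E// subr0 expr1n divr1 mulr1. Qed.

Lemma phi_gt0 y : 0 < phi y.
Proof. by rewrite phiE mulr_gt0 ?expR_gt0 ?phi_peak_gt0. Qed.

Lemma phi_mul_gauss_ratio y u :
  phi y * gauss_ratio y u = normal_pdf 0 (Num.sqrt (1 + u ^+ 2)) y.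
Proof.
have u1 := oneDsqr_gt0 u.
rewrite phiE normal_pdf_gt0E ?sqrtr_gt0// /gauss_ratio subr0 sqr_sqrtr ?(ltW u1)//.
rewrite mulrACA -expRD; congr (_ * expR _).
by field; lra.
Qed.

(** Completing the square: the joint density of mean and observation is the N(0, 1 + s^2) density of
    [y] times the posterior density of the mean, which is normal. *)
Lemma phi_convolution y x s : 0 < s ->
  phi (y - x) * (phi (x / s) * s^-1) =
  phi y * gauss_ratio y s *
    normal_pdf (y * s ^+ 2 / (1 + s ^+ 2)) (s / Num.sqrt (1 + s ^+ 2)) x.
Proof.
move=> s0; have s1 := oneDsqr_gt0 s.
have q0 : 0 < Num.sqrt (1 + s ^+ 2) by rewrite sqrtr_gt0.
have q2 : Num.sqrt (1 + s ^+ 2) ^+ 2 = 1 + s ^+ 2 by rewrite sqr_sqrtr ?ltW.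
rewrite !phiE /gauss_ratio; set q := Num.sqrt _ in q0 q2 *.
rewrite (normal_pdf_gt0E _ (s / q)) ?divr_gt0//.
transitivity (phi_peak ^+ 2 / s * (expR (- (y - x) ^+ 2 / 2) * expR (- (x / s) ^+ 2 / 2))).
  by rewrite expr2; ring.
transitivity (phi_peak ^+ 2 / s * (expR (- y ^+ 2 / 2) *
    expR (y ^+ 2 / 2 * (s ^+ 2 / (1 + s ^+ 2))) *
    expR (- (x - y * s ^+ 2 / (1 + s ^+ 2)) ^+ 2 / (2 * (s / q) ^+ 2)))); last first.
  by field; lra.
rewrite -!expRD; congr (_ * expR _).
by rewrite (expr_div_n s q) q2; field; lra.
Qed.

Lemma measurable_phi : measurable_fun setT (phi : R -> R).
Proof. exact: measurable_normal_pdf. Qed.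

Lemma has_integral_normal_pdf m s : has_integral setT (normal_pdf m s) 1.
Proof.
split; first exact: measurable_normal_pdf.
- by move=> x; exact: normal_pdf_ge0.
- exact: integral_normal_pdf.
Qed.

(** The half-line enters as an indicator, so that Tonelli's theorem applies on the whole plane. *)
Let joint t (z : R * R) : \bar R :=
  (gauss_ratio z.1 z.2 * half_cauchy t z.2 * \1_halfline z.2)%:E.

Let measurable_joint t : measurable_fun setT (joint t).
Proof.
apply/measurable_EFinP; apply: measurable_funM; last first.
  exact: (measurableT_comp (measurable_indic _)).
apply: measurable_funM; first exact: measurable_gauss_ratio_pair.
exact: (measurableT_comp (measurable_half_cauchy t)).
Qed.

Let joint_ge0 t z : 0 < t -> (0 <= joint t z)%E.
Proof.
move=> t0; rewrite lee_fin mulr_ge0 ?indicE//.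
by rewrite mulr_ge0 ?gauss_ratio_ge0 ?half_cauchy_ge0 ?(ltW t0).
Qed.

Let jointE t y : 0 < t -> (\int[mu]_u joint t (y, u) = (mix_ratio t y)%:E)%E.
Proof.
move=> t0; have [_ _ <-] := has_integral_mix_ratio t y t0.
rewrite [RHS]integral_mkcond; apply: eq_integral => u _.
by rewrite epatch_indic.
Qed.

Lemma measurable_mix_ratio t : 0 < t -> measurable_fun setT (mix_ratio t).
Proof.
move=> t0; apply/measurable_EFinP.
have := @measurable_fun_fubini_tonelli_F _ _ _ _ R mu (joint t) (measurable_joint t)
  (fun z => joint_ge0 t z t0).
by congr measurable_fun; apply/funext => y; rewrite /fubini_F jointE.
Qed.

(** This is [E f_t = 1]. By Tonelli the integral in [y] comes first; for fixed [u] it is that of a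
    centred normal density, and what remains is the mass of the mixing law. *)
Lemma has_integral_phi_mix_ratio t : 0 < t ->
  has_integral setT (fun y => phi y * mix_ratio t y) 1.
Proof.
move=> t0; split.
- by apply: measurable_funM; [exact: measurable_phi | exact: measurable_mix_ratio].
- by move=> y; rewrite mulr_ge0 ?mix_ratio_ge0 ?normal_pdf_ge0.
transitivity (\int[mu]_y \int[mu]_u ((phi y)%:E * joint t (y, u)))%E.
  apply: eq_integral => y _.
  rewrite ge0_integralZl//.
  - by rewrite jointE.
  - by apply: (measurableT_comp (measurable_joint t)).
  - by move=> u _; exact: joint_ge0.
  - by rewrite lee_fin normal_pdf_ge0.
rewrite (@fubini_tonelli _ _ _ _ _ mu mu (fun z => (phi z.1)%:E * joint t z)%E)/=; last 2 first.
- apply: emeasurable_funM; last exact: measurable_joint.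
  by apply/measurable_EFinP; exact: (measurableT_comp measurable_phi).
- by move=> z; rewrite mule_ge0 ?joint_ge0// lee_fin normal_pdf_ge0.
have [_ _ <-] := has_integral_half_cauchy t t0.
rewrite [RHS]integral_mkcond; apply: eq_integral => u _.
rewrite epatch_indic/=.
transitivity (\int[mu]_y ((half_cauchy t u * \1_halfline u)%:E *
    (normal_pdf 0 (Num.sqrt (1 + u ^+ 2)) y)%:E))%E.
  apply: eq_integral => y _; rewrite -phi_mul_gauss_ratio -!EFinM; congr EFin; ring.
have [mp p0 Ip] := has_integral_normal_pdf 0 (Num.sqrt (1 + u ^+ 2)).
rewrite ge0_integralZl_EFin//.
- by rewrite Ip mule1.
- by move=> y _; rewrite lee_fin.
- exact/measurable_EFinP.
- by rewrite mulr_ge0 ?half_cauchy_ge0 ?(ltW t0)// indicE.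
Qed.

Let joint_marginal t y (z : R * R) : \bar R :=
  (phi (y - z.1) * (phi (z.1 / (z.2 * t)) * (z.2 * t)^-1 *
    (2 / (pi * (1 + z.2 ^+ 2)))) * \1_(`]0, +oo[ : set R) z.2)%:E.

Let measurable_joint_marginal t y : measurable_fun setT (joint_marginal t y).
Proof.
have mt : measurable_fun setT (fun z : R * R => (z.2 * t)^-1).
  by apply: measurable_funV; exact: measurable_funM.
apply/measurable_EFinP; apply: measurable_funM; last first.
  exact: (measurableT_comp (measurable_indic _)).
apply: measurable_funM.
  by apply: (measurableT_comp measurable_phi); exact: measurable_funB.
apply: measurable_funM.
  apply: measurable_funM => //.
  by apply: (measurableT_comp measurable_phi); exact: measurable_funM.
apply: measurable_funM => //; apply: measurable_funV.
apply: measurable_funM => //; apply: measurable_funD => //.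
exact: measurable_funX.
Qed.

Let joint_marginal_ge0 t y z : 0 < t -> (0 <= joint_marginal t y z)%E.
Proof.
move=> t0; rewrite lee_fin indicE; case: (boolP (z.2 \in _)); last by rewrite mulr0.
rewrite inE/= in_itv/= andbT => z0; rewrite mulr1.
have z1 := oneDsqr_gt0 z.2.
by rewrite !mulr_ge0 ?normal_pdf_ge0 ?invr_ge0 ?mulr_ge0 ?pi_ge0 ?(ltW z0) ?(ltW t0) ?(ltW z1).
Qed.

(** Tonelli integrates out the mean first, where the posterior density has mass 1; the substitution
    [u = l * t] then turns the standard half-Cauchy law into [half_cauchy t]. *)
Lemma horseshoe_marginalE t y : 0 < t ->
  (\int[mu]_x ((normal_pdf 0 1 (y - x))%:E * horseshoe_density t x) =
   (phi y * mix_ratio t y)%:E)%E.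
Proof.
move=> t0.
transitivity (\int[mu]_x \int[mu]_l joint_marginal t y (x, l))%E.
  apply: eq_integral => x _.
  have mt : measurable_fun setT (fun l : R => (l * t)^-1).
    by apply: measurable_funV; exact: measurable_funM.
  rewrite /horseshoe_density integral_mkcond epatch_indic -ge0_integralZl//.
  - by apply: eq_integral => l _; rewrite -!EFinM; congr EFin; rewrite /= !mulrA.
  - apply/measurable_EFinP; apply: measurable_funM; last exact: measurable_indic.
    apply: measurable_funM.
      apply: measurable_funM => //.
      by apply: (measurableT_comp measurable_phi); exact: measurable_funM.
    apply: measurable_funM => //; apply: measurable_funV.
    by apply: measurable_funM => //; exact: measurable_funD.
  - move=> l _; rewrite -EFinM lee_fin indicE.
    case: (boolP (l \in _)); last by rewrite mulr0.
    rewrite inE/= in_itv/= andbT => l0; rewrite mulr1.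
    by rewrite !mulr_ge0 ?normal_pdf_ge0 ?invr_ge0 ?mulr_ge0 ?pi_ge0 ?(ltW l0) ?(ltW t0)
      ?(ltW (oneDsqr_gt0 l)).
  - by rewrite lee_fin normal_pdf_ge0.
rewrite fubini_tonelli; last 2 first.
- exact: measurable_joint_marginal.
- by move=> z; exact: joint_marginal_ge0.
transitivity (\int[mu]_(l in `]0%R, +oo[)
    ((phi y)%:E * (gauss_ratio y (l * t) * half_cauchy t (l * t) * t)%:E))%E.
  rewrite [RHS]integral_mkcond; apply: eq_integral => l _.
  rewrite epatch_indic/=.
  have [l0|l0] := boolP (l \in (`]0, +oo[%classic : set R)); last first.
    rewrite indicE (negbTE l0) mule0; apply: integral0_eq => x _.
    by rewrite /joint_marginal/= indicE (negbTE l0) mulr0.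
  rewrite indicE l0 mule1 -EFinM.
  move: (l0); rewrite inE/= in_itv/= andbT => l_gt0.
  have s0 : 0 < l * t by exact: mulr_gt0.
  set c := phi y * gauss_ratio y (l * t) * (2 / (pi * (1 + l ^+ 2))).
  have -> : phi y * (gauss_ratio y (l * t) * half_cauchy t (l * t) * t) = c.
    rewrite /c half_cauchyE// exprMn.
    have p0 := pi_gt0 R; have l1 := oneDsqr_gt0 l.
    have -> : t ^+ 2 + l ^+ 2 * t ^+ 2 = t ^+ 2 * (1 + l ^+ 2) by ring.
    by field; lra.
  have [mp p0 Ip] := has_integral_normal_pdf (y * (l * t) ^+ 2 / (1 + (l * t) ^+ 2))
    (l * t / Num.sqrt (1 + (l * t) ^+ 2)).
  rewrite -[RHS]mule1 -Ip -ge0_integralZl_EFin//.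
  - apply: eq_integral => x _; rewrite /joint_marginal/= indicE l0 mulr1.
    by rewrite -EFinM mulrA phi_convolution// /c; congr EFin; ring.
  - by move=> x _; rewrite lee_fin.
  - exact/measurable_EFinP.
  - by rewrite /c !mulr_ge0 ?normal_pdf_ge0 ?gauss_ratio_ge0 ?invr_ge0 ?mulr_ge0 ?pi_ge0
      ?(ltW (oneDsqr_gt0 l)).
have [mg g0 gE] := has_integral_mix_ratio t y t0.
have mgt : measurable_fun setT (fun l : R => gauss_ratio y (l * t) * half_cauchy t (l * t) * t).
  apply: measurable_funM => //; apply: (measurableT_comp mg).
  exact: measurable_funM.
rewrite ge0_integralZl_EFin//.
(* The prior uses the open half-line and [mix_ratio] the closed one; the endpoint is negligible. *)
- rewrite EFinM -gE integral_itv_obnd_cbnd; last first.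
    by apply/measurable_EFinP/measurable_funTS.
  rewrite (ge0_integral_scale (fun u => gauss_ratio y u * half_cauchy t u) t)//.
  by move=> u; apply: cvgM; [exact: continuous_gauss_ratio | exact: continuous_half_cauchy].
- by move=> l _; rewrite lee_fin mulr_ge0 ?g0 ?(ltW t0).
- exact/measurable_EFinP/measurable_funTS.
- exact: normal_pdf_ge0.
Qed.

End gaussian.

(** * Products of functions of the observations *)

Section normal_means_product.
Context {R : realType}.
Notation mu := (@lebesgue_measure R).

(** The Radon-Nikodym derivative of the normal law and [normal_pdf] have the same integral over
    every measurable set, hence agree almost everywhere. *)
Lemma ge0_integral_normal_prob (m s : R) (f : R -> \bar R) :
  measurable_fun setT f -> (forall x, 0 <= f x)%E ->
  (\int[normal_prob m s]_x f x = \int[mu]_x (f x * (normal_pdf m s x)%:E))%E.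
Proof.
move=> mf f0.
pose nu : {finite_measure set _ -> \bar R} := normal_prob m s.
have numu : nu `<< mu by exact: normal_prob_dominates.
rewrite -(Radon_Nikodym_SigmaFinite.change_of_variables numu f0 measurableT mf).
have mp : measurable_fun setT (EFin \o normal_pdf m s).
  by apply/measurable_EFinP; exact: measurable_normal_pdf.
have mg : measurable_fun setT (Radon_Nikodym_SigmaFinite.f nu mu).
  by have /integrableP[] := Radon_Nikodym_SigmaFinite.f_integrable numu.
apply: ge0_ae_eq_integral => //.
- exact: emeasurable_funM.
- exact: emeasurable_funM.
- by move=> x _; rewrite mule_ge0// Radon_Nikodym_SigmaFinite.f_ge0.
- by move=> x _; rewrite mule_ge0// lee_fin normal_pdf_ge0.
apply: ae_eqe_mul2l.
apply: integral_ae_eq => //.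
- exact: Radon_Nikodym_SigmaFinite.f_integrable.
- by move=> E _ mE; rewrite -Radon_Nikodym_SigmaFinite.f_integral.
Qed.

Lemma measurable_prod_tnth n (P : pred 'I_n) (F : 'I_n -> R -> R) :
  (forall i, measurable_fun setT (F i)) ->
  measurable_fun setT (fun y : n.-tuple R => \prod_(i < n | P i) F i (tnth y i)).
Proof.
move=> mF; elim: (index_enum _) => [|i r IHr].
  by under eq_fun do rewrite big_nil; exact: measurable_cst.
under eq_fun do rewrite big_cons; case: (P i) => //.
apply: measurable_funM => //.
by apply: (measurableT_comp (mF i)); exact: measurable_tnth.
Qed.

(** Independence, by induction on the dimension: Tonelli splits off the first coordinate. *)
Lemma ge0_integral_normal_means_prod n (theta : n.-tuple R) (F : 'I_n -> R -> R) :
  (forall i, measurable_fun setT (F i)) -> (forall i x, 0 <= F i x) ->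
  (\int[normal_means theta]_y (\prod_(i < n) F i (tnth y i))%:E =
   \prod_(i < n) \int[normal_prob (tnth theta i) 1]_x (F i x)%:E)%E.
Proof.
elim: n theta F => [|n IHn] theta F mF F0.
  rewrite big_ord0 /= integral_dirac//=; first by rewrite diracT mul1e big_ord0.
  by apply/measurable_EFinP; exact: (measurable_prod_tnth _ xpredT).
have IH := IHn [tuple of behead theta] (fun i => F (lift ord0 i))
  (fun i => mF _) (fun i => F0 _).
have {}IH : (\int[normal_means [tuple of behead theta]]_y
    (\prod_(i < n) F (lift ord0 i) (tnth y i))%:E =
    \prod_(i < n) \int[normal_prob (tnth theta (lift ord0 i)) 1]_x (F (lift ord0 i) x)%:E)%E.
  rewrite IH; apply: eq_bigr => i _.
  have -> : tnth [tuple of behead theta] i = tnth theta (lift ord0 i); last by [].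
  by rewrite tnth_behead; congr tnth; apply: val_inj => /=; rewrite inordK ?ltnS.
rewrite big_ord_recl/= ge0_integral_distribution//; last 2 first.
- by apply/measurable_EFinP; exact: (measurable_prod_tnth _ xpredT).
- by move=> y; rewrite lee_fin prodr_ge0.
pose G (y : n.-tuple R) : \bar R := (\prod_(i < n) F (lift ord0 i) (tnth y i))%:E.
have mG : measurable_fun setT G 
  by apply/measurable_EFinP; exact: (measurable_prod_tnth _ xpredT (fun i => F (lift ord0 i))).
have G0 y : (0 <= G y)%E by rewrite lee_fin prodr_ge0.
transitivity (\int[(normal_prob (thead theta) 1 \x
    normal_means [tuple of behead theta])%E]_z ((F ord0 z.1)%:E * G z.2))%E.
  apply: eq_integral => -[z y] _ /=.
  by rewrite big_ord_recl EFinM tnth0; under eq_bigr do rewrite tnthS.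
rewrite fubini_tonelli1; last 2 first.
- apply: emeasurable_funM; last exact: (measurableT_comp mG).
  by apply/measurable_EFinP; exact: (measurableT_comp (mF ord0)).
- by move=> z; rewrite mule_ge0// lee_fin.
rewrite /fubini_F/=.
transitivity (\int[normal_prob (thead theta) 1]_x ((F ord0 x)%:E *
    \prod_(i < n) \int[normal_prob (tnth theta (lift ord0 i)) 1]_x (F (lift ord0 i) x)%:E))%E.
  apply: eq_integral => x _; rewrite ge0_integralZl//; last by rewrite lee_fin.
  by rewrite -IH.
rewrite ge0_integralZr//.
- by apply/measurable_EFinP; exact: (mF ord0).
- by move=> x _; rewrite lee_fin.
- by apply: prode_ge0 => i _; apply: integral_ge0 => x _; rewrite lee_fin.
Qed.

(** Markov's inequality. Coordinates outside [S] integrate to 1, so the bound does not depend on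
    their means; this gives uniformity over the nearly black vectors. *)
Lemma normal_means_markov n (theta : n.-tuple R) (S : pred 'I_n)
    (h : R -> R) (a I : R) :
  measurable_fun setT h -> (forall x, 0 <= h x) ->
  has_integral setT (fun x => normal_pdf 0 1 x * h x) I ->
  (forall i, S i -> tnth theta i = 0) -> 0 < a ->
  (normal_means theta [set y | (a <= \prod_(i < n | S i) h (tnth y i))%R] <=
   (I ^+ #|S| / a)%:E)%E.
Proof.
move=> mh h0 [_ _ hI] S0 a0.
have mP := measurable_prod_tnth n S (fun=> h) (fun=> mh).
have P0 (y : n.-tuple R) : 0 <= \prod_(i < n | S i) h (tnth y i).
  by rewrite prodr_ge0.
rewrite EFinM lee_pdivlMr// muleC.
have mPE : measurable_fun setT
    (fun y : n.-tuple R => (\prod_(i < n | S i) h (tnth y i))%:E).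
  exact/measurable_EFinP.
have := le_integral_abse (normal_means theta) measurableT mPE a0.
rewrite setTI /=; under eq_set do rewrite ger0_norm// lee_fin.
move=> /le_trans; apply.
under eq_integral do rewrite ger0_norm//.
pose F i : R -> R := if S i then h else cst 1.
have mF i : measurable_fun setT (F i) by rewrite /F; case: ifP.
have F0 i x : 0 <= F i x by rewrite /F; case: ifP.
have -> : (\int[normal_means theta]_y (\prod_(i < n | S i) h (tnth y i))%:E =
    \int[normal_means theta]_y (\prod_(i < n) F i (tnth y i))%:E)%E.
  apply: eq_integral => y _; rewrite big_mkcond/=; congr EFin.
  by apply: eq_bigr => i _; rewrite /F; case: (S i).
rewrite ge0_integral_normal_means_prod//.
have -> : I ^+ #|S| = \prod_(i < n | S i) I by rewrite big_const -Monoid.iteropE.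
rewrite -prodEFin [leRHS]big_mkcond/= le_eqVlt; apply/orP; left; apply/eqP.
apply: eq_bigr => i _; rewrite /F; case: ifPn => [/S0 ->|_].
  rewrite ge0_integral_normal_prob//; last by apply/measurable_EFinP.
  by rewrite -hI; apply: eq_integral => x _; rewrite -EFinM mulrC.
transitivity (\int[normal_prob (tnth theta i) 1]_x (cst 1 x))%E; first by [].
by rewrite integral_cst// mul1e; exact: integral_normal_pdf.
Qed.

End normal_means_product.

(** * Exponential moments under a zero mean *)

Section null_moments.
Context {R : realType}.
Implicit Types s t u y f : R.
Notation phi := (normal_pdf 0 1).

(** From [exp x <= 1 / (1 - x)] at [x = (1 - 1 / f) / 4]. The right side is an affine function of
    [f], whose mean is 1 when [E f = 1], minus a term of chi-square type. *)
Lemma expR_oneBinv_le f : 0 < f ->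
  expR ((1 - f^-1) / 4) <= 3 / 4 + f / 4 - 3 * (f - 1) ^+ 2 / (4 * (3 * f + 1)).
Proof.
move=> f0.
have -> : 3 / 4 + f / 4 - 3 * (f - 1) ^+ 2 / (4 * (3 * f + 1)) = (1 - (1 - f^-1) / 4)^-1.
  by field; lra.
have fi : 0 < f^-1 by rewrite invr_gt0.
rewrite -[leLHS]invrK -expRN lef_pV2 ?posrE ?expR_gt0//; last by lra.
exact: expR_ge1Dx.
Qed.

(** With [q = sqrt f], the gap is [(1 - q)^2 / 2], and [d <= 1 - f <= 2 (1 - q)]. *)
Lemma sqrt_le_center f d : 0 <= d -> 0 <= f -> f <= 1 - d ->
  Num.sqrt f + d ^+ 2 / 8 <= (1 + f) / 2.
Proof.
move=> d0 f0 fd; set q := Num.sqrt f.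
have q0 : 0 <= q by exact: sqrtr_ge0.
have qf : q ^+ 2 = f by rewrite sqr_sqrtr.
have q1 : q <= 1 by nra.
have : d <= 2 * (1 - q) by nra.
nra.
Qed.

Lemma sqrt_le_mean f : 0 <= f -> Num.sqrt f <= (1 + f) / 2.
Proof.
move=> f0; have := sqr_sqrtr f0; have := sqr_ge0 (Num.sqrt f - 1); nra.
Qed.

(** Collects the loss on [[0, 1]]: the minimum of the normal density there, times [(t / 116)^2 / 8]
    without its [t^2]. *)
Definition hellinger_const : R := phi_peak * expR (- 1 / 2) / (8 * 116 ^+ 2).

Lemma hellinger_const_gt0 : 0 < hellinger_const.
Proof. by rewrite divr_gt0// mulr_gt0 ?phi_peak_gt0 ?expR_gt0. Qed.

(** The bound [sqrt f <= (1 + f) / 2] has mean 1; a quantitative form of it on [[0, 1]] provides the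
    loss of order [t^2]. *)
Lemma has_integral_phi_sqrt_mix_ratio t : 0 < t -> t <= 2 ->
  exists2 I, has_integral setT (fun y => phi y * Num.sqrt (mix_ratio t y)) I &
    0 <= I <= 1 - hellinger_const * t ^+ 2.
Proof.
move=> t0 t2; have mT : measurable [set: R] by [].
have h2 : 0 <= 1 / 2 :> R by lra.
have hR := has_integralD mT (has_integralZ mT h2 (has_integral_normal_pdf 0 1))
  (has_integralZ mT h2 (has_integral_phi_mix_ratio t t0)).
have mg : measurable_fun setT (fun y => phi y * Num.sqrt (mix_ratio t y)).
  apply: measurable_funM; first exact: measurable_phi.
  by apply: (measurableT_comp measurable_sqrt); exact: measurable_mix_ratio.
have g0 y : 0 <= phi y * Num.sqrt (mix_ratio t y).
  by rewrite mulr_ge0 ?normal_pdf_ge0 ?sqrtr_ge0.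
have gh y : phi y * Num.sqrt (mix_ratio t y) <=
    1 / 2 * phi y + 1 / 2 * (phi y * mix_ratio t y).
  have := sqrt_le_mean _ (mix_ratio_ge0 t y t0); have := phi_gt0 y; nra.
have hI := has_integral_dominated _ _ _ _ mT mg g0 hR (fun y _ => gh y).
eexists; first exact: hI.
rewrite (has_integral_ge0 hI)/=.
have c0 : 0 <= hellinger_const * t ^+ 2.
  by rewrite mulr_ge0 ?exprn_ge0 ?(ltW t0) ?(ltW hellinger_const_gt0).
have := has_integral_le mT
  (has_integralD mT hI (has_integralZ mT c0 (has_integral_itv mT ler01 (@subsetT _ _)))) hR.
suff H y : [set: R] y -> phi y * Num.sqrt (mix_ratio t y) +
    hellinger_const * t ^+ 2 * \1_`[0, 1] y <=
    1 / 2 * phi y + 1 / 2 * (phi y * mix_ratio t y).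
  by move=> /(_ H); lra.
move=> _; rewrite indicE; case: (boolP (y \in _)); last by rewrite mulr0 addr0.
rewrite inE/= in_itv/= => /andP[y0 y1]; rewrite mulr1.
have y21 : y ^+ 2 <= 1 by nra.
have fc := mix_ratio_le_center t y y21 t0 t2.
have d0 : 0 <= t / 116 by lra.
have := sqrt_le_center _ _ d0 (mix_ratio_ge0 t y t0) fc.
have : phi_peak * expR (- 1 / 2) <= phi y.
  by rewrite phiE ler_wpM2l ?(ltW phi_peak_gt0)// ler_expR; lra.
have -> : hellinger_const * t ^+ 2 = phi_peak * expR (- 1 / 2) * ((t / 116) ^+ 2 / 8).
  by rewrite /hellinger_const; field.
have := phi_gt0 y; have : 0 <= (t / 116) ^+ 2 / 8 by rewrite divr_ge0 ?sqr_ge0.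
move: (phi_peak * _) ((t / 116) ^+ 2 / 8) (phi y) (Num.sqrt (mix_ratio t y)) (mix_ratio t y).
move=> a d b q f d0' b0 ab h; nra.
Qed.

(** With [x = y^2 / 4], the tail bound is [t exp x * exp x / (240 x)]. The first exponential
    compensates [t], as [x >= ln (1 / t)]; the second is at least [x^2 / 2 >= 480 x], whence the
    threshold 960. *)
Lemma mix_ratio_ge2 t y : 0 < t -> t <= 1 -> 960 <= ln t^-1 ->
  2 * Num.sqrt (ln t^-1) <= y -> 2 <= mix_ratio t y.
Proof.
move=> t0 t1 L0; set L := ln t^-1 in L0 *.
have q0 : 0 <= Num.sqrt L by exact: sqrtr_ge0.
have qL : Num.sqrt L ^+ 2 = L by rewrite sqr_sqrtr//; lra.
set q := Num.sqrt L in q0 qL * => qy.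
have y1 : 1 <= y by nra.
apply: le_trans (mix_ratio_ge_tail t y t0 t1 y1).
have -> : y ^+ 2 / 2 = y ^+ 2 / 4 + y ^+ 2 / 4 by field.
set x := y ^+ 2 / 4; have xL : L <= x by rewrite /x; nra.
have -> : 60 * y ^+ 2 = 240 * x by rewrite /x; field.
have x_gt0 : 0 < 240 * x by lra.
rewrite expRD ler_pdivlMr//.
have e1 : 480 * x <= expR x.
  have x0 : 0 <= x by lra.
  by have := @expR_ge1Dxn R x 1 x0; rewrite !factS fact0/=; nra.
have e2 : t^-1 <= expR x.
  by rewrite -[leLHS](@lnK R) ?posrE ?invr_gt0// ler_expR.
have e3 : 1 <= t * expR x by rewrite mulrC -ler_pdivrMr// div1r.
nra.
Qed.

Definition chi2_const : R := phi_peak / (128 * 120).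

Lemma chi2_const_gt0 : 0 < chi2_const.
Proof. by apply: divr_gt0; [exact: phi_peak_gt0 | lra]. Qed.

(* The loss comes from [y] in [[z, 2z]] with [z = 2 sqrt (ln (1/t))], where
   [mix_ratio t y >= 2] and the marginal density is of order [t / y^2]. *)
Lemma has_integral_phi_expR_mix_ratio t : 0 < t -> t < 1 -> 960 <= ln t^-1 ->
  exists2 I, has_integral setT (fun y => phi y * expR ((1 - (mix_ratio t y)^-1) / 4)) I &
    0 <= I <= 1 - chi2_const * t / Num.sqrt (ln t^-1).
Proof.
move=> t0 t1 L0; have mT : measurable [set: R] by [].
have f0 y : 0 < mix_ratio t y by apply: lt_le_trans (mix_ratio_ge t y t0); lra.
have h3 : 0 <= 3 / 4 :> R by lra.
have h4 : 0 <= 1 / 4 :> R by lra.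
have hR := has_integralD mT (has_integralZ mT h3 (has_integral_normal_pdf 0 1))
  (has_integralZ mT h4 (has_integral_phi_mix_ratio t t0)).
have mg : measurable_fun setT (fun y => phi y * expR ((1 - (mix_ratio t y)^-1) / 4)).
  apply: measurable_funM; first exact: measurable_phi.
  apply: (measurableT_comp (@measurable_expR R)); apply: measurable_funM => //.
  by apply: measurable_funB => //; apply: measurable_funV; exact: measurable_mix_ratio.
have g0 y : 0 <= phi y * expR ((1 - (mix_ratio t y)^-1) / 4).
  by rewrite mulr_ge0 ?normal_pdf_ge0 ?expR_ge0.
have gh y : phi y * expR ((1 - (mix_ratio t y)^-1) / 4) <=
    3 / 4 * phi y + 1 / 4 * (phi y * mix_ratio t y) -
    phi y * (3 * (mix_ratio t y - 1) ^+ 2 / (4 * (3 * mix_ratio t y + 1))).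
  have := expR_oneBinv_le _ (f0 y); have := phi_gt0 y; nra.
have l0 y : 0 <= phi y * (3 * (mix_ratio t y - 1) ^+ 2 / (4 * (3 * mix_ratio t y + 1))).
  have f1 := f0 y.
  rewrite mulr_ge0 ?normal_pdf_ge0// divr_ge0//; last by lra.
  by rewrite mulr_ge0// sqr_ge0.
have gh' y : phi y * expR ((1 - (mix_ratio t y)^-1) / 4) <=
    3 / 4 * phi y + 1 / 4 * (phi y * mix_ratio t y).
  by apply: le_trans (gh y) _; rewrite lerBlDr lerDl.
have hI := has_integral_dominated _ _ _ _ mT mg g0 hR (fun y _ => gh' y).
eexists; first exact: hI.
rewrite (has_integral_ge0 hI)/=.
set L := ln t^-1 in L0 *.
have q0 : 0 <= Num.sqrt L by exact: sqrtr_ge0.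
have qL : Num.sqrt L ^+ 2 = L by rewrite sqr_sqrtr//; lra.
set q := Num.sqrt L in q0 qL *; have q1 : 1 <= q by nra.
(* The loss is at least [phi_peak * t / (16 * 120 * y^2)], and [k] is this bound at the right end
   [y = 4 q]. Multiplied by the length [2 q] it yields [chi2_const * t / q]. *)
set k := phi_peak * t / (256 * 120 * q ^+ 2).
have p0 := @phi_peak_gt0 R.
have k0 : 0 <= k.
  apply: divr_ge0; first by rewrite mulr_ge0 ?(ltW p0) ?(ltW t0).
  by nra.
have zz : 2 * q <= 2 * (2 * q) by lra.
have := has_integral_le mT
  (has_integralD mT hI (has_integralZ mT k0 (has_integral_itv mT zz (@subsetT _ _)))) hR.
have -> : k * (2 * (2 * q) - 2 * q) = chi2_const * t / q.
  by rewrite /k /chi2_const; field; lra.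
suff H y : [set: R] y -> phi y * expR ((1 - (mix_ratio t y)^-1) / 4) +
    k * \1_`[2 * q, 2 * (2 * q)] y <=
    3 / 4 * phi y + 1 / 4 * (phi y * mix_ratio t y).
  by move=> /(_ H); lra.
move=> _; rewrite indicE; case: (boolP (y \in _)); last by rewrite mulr0 addr0.
rewrite inE/= in_itv/= => /andP[zy yz]; rewrite mulr1.
have f2 : 2 <= mix_ratio t y by apply: mix_ratio_ge2 => //; exact: ltW.
have y1 : 1 <= y by lra.
apply: le_trans (lerD (gh y) (lexx _)) _.
rewrite -addrA -[leRHS]addr0 lerD2l addrC subr_le0.
(* For a ratio [f >= 2], [f - 1 >= f / 2] and [3 f + 1 <= 4 f]: the quadratic loss is linear in
   [f]. *)
have fx : mix_ratio t y / 32 <=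
    3 * (mix_ratio t y - 1) ^+ 2 / (4 * (3 * mix_ratio t y + 1)).
  by rewrite ler_pdivlMr; nra.
have ft := mix_ratio_ge_tail t y t0 (ltW t1) y1.
have y0 : 0 < y by lra.
have yy0 : 0 < y ^+ 2 by exact: exprn_gt0.
apply: le_trans (ler_wpM2l (normal_pdf_ge0 _ _ _) (le_trans (ler_wpM2r _ ft) fx)); last by lra.
rewrite phiE.
have -> : phi_peak * expR (- y ^+ 2 / 2) * (t * expR (y ^+ 2 / 2) / (60 * y ^+ 2) / 32) =
    phi_peak * t / (16 * 120 * y ^+ 2).
  by rewrite mulNr expRN; have e0 := expR_gt0 (y ^+ 2 / 2); field; lra.
rewrite /k ler_wpM2l ?mulr_ge0 ?(ltW p0) ?(ltW t0)// lef_pV2 ?posrE; nra.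
Qed.

End null_moments.

(** * Likelihood ratios *)

Section likelihood_ratio.
Context {R : realType}.
Implicit Types s t : R.

Definition mix_prod n (y : n.-tuple R) t : R := \prod_(i < n) mix_ratio t (tnth y i).

Lemma marginal_likelihoodE n (y : n.-tuple R) t : 0 < t ->
  marginal_likelihood y t =
  ((\prod_(i < n) normal_pdf 0 1 (tnth y i)) * mix_prod n y t)%:E.
Proof.
move=> t0; rewrite /marginal_likelihood.
under eq_bigr do rewrite horseshoe_marginalE//.
by rewrite prodEFin big_split.
Qed.

Lemma marginal_likelihood_le n (y : n.-tuple R) s t : 0 < s -> 0 < t ->
  (marginal_likelihood y s <= marginal_likelihood y t)%E =
  (mix_prod n y s <= mix_prod n y t).
Proof.
move=> s0 t0; rewrite !marginal_likelihoodE// lee_fin ler_pM2l//.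
by apply: prodr_gt0 => i _; exact: phi_gt0.
Qed.

Lemma mix_ratio_gt0 t y : 0 < t -> t < 1 -> 0 < mix_ratio t y.
Proof. by move=> t0 t1; apply: lt_le_trans (mix_ratio_ge t y t0); lra. Qed.

Lemma mix_prod_gt0 n (y : n.-tuple R) t : 0 < t -> t < 1 -> 0 < mix_prod n y t.
Proof. by move=> t0 t1; apply: prodr_gt0 => i _; exact: mix_ratio_gt0. Qed.

(** Dividing the affine bound by [f_s] gives [1 + (t / s - 1) (1 - 1 / f_s) + t^2 / f_s]; the
    condition [s <= 1 / 2] ensures [f_s >= 1 / 2], and [1 + x <= exp x] concludes. *)
Lemma mix_ratio_le_expR s t y : 0 < s -> s <= 1 / 2 -> s <= t ->
  mix_ratio t y <=
  mix_ratio s y * expR ((t / s - 1) * (1 - (mix_ratio s y)^-1) + 2 * t ^+ 2).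
Proof.
move=> s0 s1 st; have f2 : 1 / 2 <= mix_ratio s y.
  by apply: le_trans (mix_ratio_ge s y s0); lra.
apply: le_trans (mix_ratio_le_affine s t y s0 st) _.
have f0 : 0 < mix_ratio s y by lra.
apply: le_trans (ler_wpM2l (ltW f0) (expR_ge1Dx _)).
have -> : mix_ratio s y * (1 + ((t / s - 1) * (1 - (mix_ratio s y)^-1) + 2 * t ^+ 2)) =
    1 + t / s * (mix_ratio s y - 1) + 2 * t ^+ 2 * mix_ratio s y.
  by field; lra.
have := sqr_ge0 t; nra.
Qed.

Lemma prod_expr_card n (S : pred 'I_n) (p : nat) (a : R) : 1 <= a ->
  (#|S| <= p)%N -> \prod_(i < n | S i) a <= a ^+ p.
Proof. by move=> a1 Sp; rewrite big_const -Monoid.iteropE ler_weXn2l. Qed.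

Lemma prod_mix_ratio_outliers n (S : pred 'I_n) (p : nat) (y : n.-tuple R) s t :
  0 < s -> s <= t -> (#|S| <= p)%N ->
  \prod_(i < n | S i) mix_ratio t (tnth y i) <=
  (\prod_(i < n | S i) mix_ratio s (tnth y i)) * (t / s) ^+ p.
Proof.
move=> s0 st Sp; have t0 : 0 < t by lra.
have r1 : 1 <= t / s by rewrite ler_pdivlMr// mul1r.
apply: le_trans (_ : _ <= \prod_(i < n | S i) (mix_ratio s (tnth y i) * (t / s))) _.
  apply: ler_prod => i _; rewrite mix_ratio_ge0//= mulrC.
  exact: mix_ratio_le_scale.
rewrite big_split/= ler_wpM2l ?prod_expr_card//.
by apply: prodr_ge0 => i _; exact: mix_ratio_ge0.
Qed.

(** Coordinates in [S], later those with zero mean, use the exponential bound; the at most [p]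
    others cost a factor [t / s] each. *)
Lemma mix_prod_le_expR n (S : pred 'I_n) (p : nat) (y : n.-tuple R) s t :
  0 < s -> s <= 1 / 2 -> s <= t -> (#|predC S| <= p)%N ->
  mix_prod n y t <= mix_prod n y s *
    expR ((t / s - 1) * \sum_(i < n | S i) (1 - (mix_ratio s (tnth y i))^-1) +
      2 * n%:R * t ^+ 2 + p%:R * ln (t / s)).
Proof.
move=> s0 s1 st Sp; have t0 : 0 < t by lra.
have r0 : 0 < t / s by rewrite divr_gt0.
rewrite /mix_prod (bigID S)/= [X in _ <= X * _](bigID S)/=.
rewrite expRD expRM_natl lnK ?posrE// mulrACA.
rewrite ler_pM ?prodr_ge0//.
- by move=> i _; exact: mix_ratio_ge0.
- by move=> i _; exact: mix_ratio_ge0.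
- apply: le_trans (_ : _ <= \prod_(i < n | S i) (mix_ratio s (tnth y i) *
     expR ((t / s - 1) * (1 - (mix_ratio s (tnth y i))^-1) + 2 * t ^+ 2))) _.
    by apply: ler_prod => i _; rewrite mix_ratio_ge0//=; exact: mix_ratio_le_expR.
  rewrite big_split/= ler_wpM2l ?prodr_ge0//.
    by move=> i _; exact: mix_ratio_ge0.
  rewrite -expR_sum ler_expR big_split/= -mulr_sumr lerD2l.
  have -> : 2 * n%:R * t ^+ 2 = n%:R * (2 * t ^+ 2) by ring.
  rewrite sumr_const -[leLHS]mulr_natl ler_wpM2r//.
    by rewrite mulr_ge0 ?sqr_ge0.
  by rewrite ler_nat (leq_trans (max_card _))// card_ord.
- exact: (@prod_mix_ratio_outliers n (predC S)).
Qed.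

Lemma onem_ge_expR (t : R) : 0 <= t -> t <= 1 / 2 -> expR (- (2 * t)) <= 1 - t.
Proof.
move=> t0 t1; rewrite expRN -div1r ler_pdivrMr ?expR_gt0//.
have := @expR_ge1Dx R (2 * t); nra.
Qed.

(* Here [s] is the reference value, and [u] a grid point just below [t]. *)
Lemma mix_prod_le_grid n (S : pred 'I_n) (p : nat) (y : n.-tuple R) s t u b d :
  0 < s -> s <= 1 / 2 -> s <= t -> 0 < u -> u <= t -> t / u <= 1 + d ->
  (#|predC S| <= p)%N -> 0 <= d ->
  \prod_(i < n | S i) Num.sqrt (mix_ratio u (tnth y i)) <= expR (- b) ->
  mix_prod n y t <= mix_prod n y s *
    expR (n%:R * d - 2 * b + 2 * s * n%:R + p%:R * ln (t / s)).
Proof.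
move=> s0 s1 st u0 ut tu Sp d0 hb; have t0 : 0 < t by lra.
have r0 : 0 < t / s by rewrite divr_gt0.
rewrite /mix_prod (bigID S)/= [X in _ <= X * _](bigID S)/=.
rewrite expRD expRM_natl lnK ?posrE// mulrACA.
rewrite ler_pM ?prodr_ge0//; last exact: (@prod_mix_ratio_outliers n (predC S)).
- by move=> i _; exact: mix_ratio_ge0.
- by move=> i _; exact: mix_ratio_ge0.
have Sn : (#|S| <= n)%N by rewrite (leq_trans (max_card _))// card_ord.
have tu1 : 1 <= t / u by rewrite ler_pdivlMr// mul1r.
(* Passing from [u] to [t] costs at most [(1 + d)^n <= exp (n d)]; at [u], the product is the square
   of the one in [hb]. *)
have h1 : \prod_(i < n | S i) mix_ratio t (tnth y i) <= expR (n%:R * d) * expR (- (2 * b)).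
  apply: le_trans (prod_mix_ratio_outliers n S n y u t u0 ut Sn) _.
  rewrite mulrC ler_pM ?exprn_ge0 ?prodr_ge0 ?(le_trans _ tu1)//.
  - by move=> i _; exact: mix_ratio_ge0.
  - rewrite expRM_natl lerXn2r ?nnegrE ?expR_ge0 ?(le_trans _ tu1)//.
    exact: le_trans tu (expR_ge1Dx _).
  - have -> : - (2 * b) = 2 * - b by ring.
    rewrite expRM_natl.
    under eq_bigr => i _ do rewrite -(sqr_sqrtr (mix_ratio_ge0 u (tnth y i) u0)).
    by rewrite prodrXl lerXn2r ?nnegrE ?expR_ge0 ?prodr_ge0.
(* Each factor at the reference is at least [1 - s >= exp (- 2 s)]. *)
have h2 : expR (- (2 * s * n%:R)) <= \prod_(i < n | S i) mix_ratio s (tnth y i).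
  apply: le_trans (_ : _ <= \prod_(i < n | S i) expR (- (2 * s))) _.
    rewrite -expR_sum ler_expR sumr_const mulNrn lerN2 -[leLHS]mulr_natr.
    by rewrite ler_wpM2l ?ler_nat// mulr_ge0// ltW.
  apply: ler_prod => i _; rewrite expR_ge0/=.
  by apply: le_trans (mix_ratio_ge s _ s0); apply: onem_ge_expR => //; exact: ltW.
apply: le_trans h1 _.
rewrite -expRD -ler_pdivrMr ?expR_gt0// -expRB; apply: le_trans h2.
by rewrite ler_expR; lra.
Qed.

End likelihood_ratio.

(** * A bound at fixed [n]: [t] is the rate, [t0] the border between small and large parameters *)

Section mmle_probability_bound.
Context {R : realType}.
Implicit Types s t : R.

Lemma measure_bigsetU_le d (T : measurableType d) (P : probability T R)
    (F : nat -> set T) (e : R) n :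
  (forall k, measurable (F k)) -> (forall k, (k < n)%N -> P (F k) <= e%:E)%E ->
  (P (\big[setU/set0]_(k < n) F k) <= (n%:R * e)%:E)%E.
Proof.
move=> mF; elim: n => [|n IHn] Fe; first by rewrite big_ord0 measure0 mul0r.
rewrite big_ord_recr/= -natr1 mulrDl mul1r EFinD.
apply: le_trans (leeD (IHn (fun k kn => Fe k (ltnW kn))) (Fe n (ltnSn n))).
by apply: measureU2 => //; exact: bigsetU_measurable.
Qed.

(** Here [ln r = 2 ln (sqrt r) < 2 sqrt r], and [sqrt r * c >= 8] turns [2 sqrt r] into at most
    [r c / 4]. *)
Lemma ln_le_linear (c r : R) : 0 < c -> 2 + 64 / c ^+ 2 <= r -> ln r < r * c / 4.
Proof.
move=> c0 rc; have c2 : 0 < c ^+ 2 by exact: exprn_gt0.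
have k0 : 0 < 64 / c ^+ 2 by rewrite divr_gt0.
have r0 : 0 < r by lra.
have q0 : 0 < Num.sqrt r by rewrite sqrtr_gt0.
have qr : Num.sqrt r ^+ 2 = r by rewrite sqr_sqrtr ?ltW.
move: (Num.sqrt r) q0 qr => q q0 qr.
have -> : ln r = 2 * ln q by rewrite -qr lnXn// mulr_natl.
have := ln_sublinear q0.
have : 8 <= q * c.
  rewrite -(@ler_pXn2r _ 2) ?nnegrE ?mulr_ge0 ?(ltW q0) ?(ltW c0)// exprMn qr.
  rewrite -ler_pdivrMr//; lra.
move: (ln q) => l; nra.
Qed.

Lemma measurable_prod_ge n (S : pred 'I_n) (h : R -> R) (a : R) :
  measurable_fun setT h ->
  measurable [set y : n.-tuple R | a <= \prod_(i < n | S i) h (tnth y i)].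
Proof.
move=> mh; rewrite -[X in measurable X]setTI.
have mP := measurable_prod_tnth n S (fun=> h) (fun=> mh).
have -> : [set y : n.-tuple R | a <= \prod_(i < n | S i) h (tnth y i)] =
  (fun y : n.-tuple R => \prod_(i < n | S i) h (tnth y i)) @^-1` `[a, +oo[.
  by apply/seteqP; split => y /=; rewrite in_itv/= andbT.
exact: mP.
Qed.

(** Half of the exponent pays for the threshold in Markov's inequality, the other half bounds the
    probability. *)
Lemma pow_expR_div (I e : R) m : 0 <= I -> I <= expR (- (2 * e)) ->
  I ^+ m / expR (- (m%:R * e)) <= expR (- (m%:R * e)).
Proof.
move=> I0 Ie; rewrite ler_pdivrMr ?expR_gt0// -expRD.
have -> : - (m%:R * e) + - (m%:R * e) = m%:R * - (2 * e) by ring.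
by rewrite expRM_natl lerXn2r ?nnegrE ?expR_ge0.
Qed.

Lemma onem_le_expR (I e : R) : I <= 1 - 2 * e -> I <= expR (- (2 * e)).
Proof. by move=> h; apply: le_trans h (expR_ge1Dx _). Qed.

Variables (n p : nat) (L t t0 : R).
Hypotheses (p_gt0 : (0 < p)%N) (pn : (p.*2 <= n)%N).
Hypotheses (tE : t = p%:R / n%:R * Num.sqrt L) (LE : L = ln (n%:R / p%:R)).
Hypotheses (L1 : 1 <= L) (t_le : t <= 1 / 2) (t_small : 960 <= ln t^-1).
Hypotheses (t0E : t0 = chi2_const / (16 * Num.sqrt L)) (t01 : t0 <= 1).
Hypothesis big : (n%:R * t0)^-1 + 2 * t * n%:R + p%:R * L <
  n%:R * hellinger_const * t0 ^+ 2 / 2.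

Let p0 : 0 < p%:R :> R. Proof. by rewrite ltr0n. Qed.

Let n0 : 0 < n%:R :> R.
Proof. by rewrite ltr0n (leq_trans _ pn)// double_gt0. Qed.

Let q := Num.sqrt L.

Let q1 : 1 <= q. Proof. by rewrite -[leLHS]sqrtr1 ler_wsqrtr. Qed.

Let q_gt0 : 0 < q. Proof. exact: lt_le_trans ltr01 q1. Qed.

Let ntE : n%:R * t = p%:R * q.
Proof. by rewrite tE -/q; field; rewrite gt_eqF. Qed.

Let t_gt0 : 0 < t.
Proof. by rewrite -(pmulr_rgt0 _ n0) ntE mulr_gt0. Qed.

Let t0_gt0 : 0 < t0.
Proof. by rewrite t0E divr_gt0 ?chi2_const_gt0// mulr_gt0. Qed.

Let lnVt_le : ln t^-1 <= L.
Proof.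
rewrite LE ler_ln ?posrE ?invr_gt0 ?divr_gt0//.
rewrite -[leRHS]invrK lef_pV2 ?posrE ?invr_gt0 ?divr_gt0// invf_div.
by rewrite tE -/q ler_peMr// divr_ge0// ltW.
Qed.

Let delta := chi2_const * t / Num.sqrt (ln t^-1).

(** The factor [sqrt L] in [n t = p sqrt L] offsets [sqrt (ln (1 / t)) <= sqrt L], so the total
    drift is of order [p]. *)
Let n_delta : chi2_const * p%:R <= n%:R * delta.
Proof.
have s0 : 0 < Num.sqrt (ln t^-1) by rewrite sqrtr_gt0; have := t_small; lra.
rewrite /delta (_ : n%:R * _ = chi2_const * (n%:R * t) / Num.sqrt (ln t^-1)); last by ring.
rewrite ntE ler_pdivlMr// -mulrA ler_pM2l ?chi2_const_gt0// ler_pM2l//.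
exact: ler_wsqrtr.
Qed.

Section fixed_mean.
Variables (theta : n.-tuple R) (theta_black : nearly_black R n p theta).

Let S : pred 'I_n := [pred i | tnth theta i == 0].

Let CS : (#|predC S| <= p)%N. Proof. exact: theta_black. Qed.

(** As [p <= n / 2], at least half of the means vanish. *)
Let mS : n%:R <= 2 * #|S|%:R :> R.
Proof.
have ab : (#|S| + #|predC S| = n)%N by rewrite cardC card_ord.
have pS : (p <= #|S|)%N.
  by rewrite -(leq_add2r p) addnn (leq_trans pn)// -[leqLHS]ab leq_add2l.
by rewrite -natrM ler_nat mul2n -addnn -[leqLHS]ab leq_add2l (leq_trans CS).
Qed.

Let m := #|S|%:R : R.

(** In logarithms, the complement says that the sum of the [W (Y_i)] over zero means is below
    [- 2 m delta]; the product form suits Markov's inequality. *)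
Definition bad_score : set (n.-tuple R) :=
  [set y | expR (- (m * (delta / 2))) <=
    \prod_(i < n | S i) expR ((1 - (mix_ratio t (tnth y i))^-1) / 4)].

(** For [k] up to [n^2] the points [t0 + k / n^2] run from [t0] to [t0 + 1], past the right end of
    the parameter range. *)
Definition bad_grid (k : nat) : set (n.-tuple R) :=
  [set y | expR (- (m * (hellinger_const * t0 ^+ 2 / 2))) <=
    \prod_(i < n | S i) Num.sqrt (mix_ratio (t0 + k%:R / n%:R ^+ 2) (tnth y i))].

Lemma measurable_bad_score : measurable bad_score.
Proof.
apply: (measurable_prod_ge n S (fun x => expR ((1 - (mix_ratio t x)^-1) / 4))).
apply: (measurableT_comp (@measurable_expR R)); apply: measurable_funM => //.
by apply: measurable_funB => //; apply: measurable_funV; exact: measurable_mix_ratio.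
Qed.

Let grid_gt0 k : 0 < t0 + k%:R / n%:R ^+ 2.
Proof. by rewrite ltr_pwDl// divr_ge0// exprn_ge0// ltW. Qed.

Lemma measurable_bad_grid k : measurable (bad_grid k).
Proof.
apply: (measurable_prod_ge n S
  (fun x => Num.sqrt (mix_ratio (t0 + k%:R / n%:R ^+ 2) x))).
by apply: (measurableT_comp measurable_sqrt); exact: measurable_mix_ratio.
Qed.

Lemma bad_score_le :
  (normal_means theta bad_score <= (expR (- (chi2_const * p%:R / 4)))%:E)%E.
Proof.
have t1 : t < 1 by have := t_le; lra.
have [I hI /andP[I0 I1]] := has_integral_phi_expR_mix_ratio t t_gt0 t1 t_small.
apply: le_trans (normal_means_markov n theta S _ _ _ _ _ hI _ (expR_gt0 _)) _.
- apply: (measurableT_comp (@measurable_expR R)); apply: measurable_funM => //.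
  by apply: measurable_funB => //; apply: measurable_funV; exact: measurable_mix_ratio.
- by move=> x; exact: expR_ge0.
- by move=> i /eqP.
rewrite lee_fin; apply: le_trans (pow_expR_div I (delta / 2) #|S| I0 _) _.
  by apply: onem_le_expR; rewrite mulrC divfK.
rewrite ler_expR lerN2.
have d0 : 0 <= delta.
  by rewrite -(pmulr_rge0 _ n0); apply: le_trans n_delta; rewrite mulr_ge0 ?ltW ?chi2_const_gt0.
have := mS; have := n_delta; rewrite -/m; nra.
Qed.

Lemma bad_grid_le k : (k <= n ^ 2)%N ->
  (normal_means theta (bad_grid k) <=
   (expR (- (n%:R * hellinger_const * t0 ^+ 2 / 4)))%:E)%E.
Proof.
move=> kn; set u := t0 + k%:R / n%:R ^+ 2.
have h0 := @hellinger_const_gt0 R.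
have u2 : u <= 2.
  have : k%:R / n%:R ^+ 2 <= 1 :> R by rewrite ler_pdivrMr ?exprn_gt0// mul1r -natrX ler_nat.
  by have := t01; rewrite /u; lra.
have tu : t0 <= u by rewrite /u lerDl divr_ge0// exprn_ge0// ltW.
have [I hI /andP[I0 I1]] := has_integral_phi_sqrt_mix_ratio u (grid_gt0 k) u2.
apply: le_trans (normal_means_markov n theta S _ _ _ _ _ hI _ (expR_gt0 _)) _.
- by apply: (measurableT_comp measurable_sqrt); exact: (measurable_mix_ratio _ (grid_gt0 k)).
- by move=> x; exact: sqrtr_ge0.
- by move=> i /eqP.
rewrite lee_fin; apply: le_trans (pow_expR_div I (hellinger_const * t0 ^+ 2 / 2) #|S| I0 _) _.
  apply: onem_le_expR; apply: (le_trans I1).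
  rewrite [2 * _]mulrC divfK// lerD2l lerN2 ler_pM2l//.
  by rewrite ler_pXn2r ?nnegrE ?(ltW t0_gt0) ?(ltW (grid_gt0 k)).
rewrite ler_expR lerN2; have := mS; rewrite -/m.
have : 0 <= hellinger_const * t0 ^+ 2 by rewrite mulr_ge0 ?sqr_ge0 ?ltW.
nra.
Qed.

Let t_lt1 : t < 1. Proof. by have := t_le; lra. Qed.

(** The threshold of [ln_le_linear] at [chi2_const]: beyond it the outliers' gain [p ln r] is below
    [chi2_const p r / 4]. *)
Definition mmle_const : R := 2 + 64 / chi2_const ^+ 2.

Lemma mmle_const_ge2 : 2 <= mmle_const.
Proof. by rewrite lerDl divr_ge0 ?exprn_ge0 ?(ltW chi2_const_gt0). Qed.

(** With [r = s / t > 2] and [a = chi2_const p], the drift is at most [- (r - 1) a], the quadratic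
    error at most [r a / 8] and the outliers' gain less than [r a / 4]; the total is negative. *)
Lemma mix_prod_lt_small (y : n.-tuple R) s : ~ bad_score y ->
  mmle_const * t < s -> s <= t0 -> mix_prod n y s < mix_prod n y t.
Proof.
move=> /negP; rewrite -ltNge => bs Ks s0.
have c0 := @chi2_const_gt0 R; have K2 := mmle_const_ge2.
have tg := t_gt0; have qg := q_gt0; have pg := p0.
have ts : t <= s by nra.
set r := s / t; have sE : s = r * t by rewrite /r divfK// gt_eqF.
have rK : mmle_const < r by rewrite ltr_pdivlMr.
have r0 : 0 < r by lra.
apply: le_lt_trans (mix_prod_le_expR n S p y t s t_gt0 t_le ts CS) _.
rewrite -[ltRHS]mulr1 ltr_pM2l ?mix_prod_gt0// expR_lt1 -/r.
set W := \sum_(i < n | S i) _.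
have {bs}W0 : W <= - (2 * m * delta).
  move: bs; rewrite -expR_sum ltr_expR -mulr_suml -/W; lra.
have mn : chi2_const * p%:R <= 2 * m * delta.
  apply: le_trans n_delta _; rewrite ler_wpM2r ?mS//.
  by rewrite -(pmulr_rge0 _ n0); apply: le_trans n_delta; rewrite mulr_ge0 ?ltW.
have h1 : (r - 1) * W <= - ((r - 1) * (chi2_const * p%:R)).
  by rewrite -mulrN ler_wpM2l; lra.
(* The value of [t0] is chosen for this: [2 n s^2 <= 2 p q r t0], and [16 q t0] is [chi2_const]. *)
have h2 : 2 * n%:R * s ^+ 2 <= r * (chi2_const * p%:R) / 8.
  have -> : 2 * n%:R * s ^+ 2 = 2 * (n%:R * t) * r * s by rewrite expr2 {1}sE; ring.
  rewrite ntE; apply: le_trans (_ : _ <= 2 * (p%:R * q) * r * t0) _.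
    by apply: ler_wpM2l => //; apply/ltW/mulr_gt0 => //; do 2 apply: mulr_gt0 => //.
  rewrite t0E -/q le_eqVlt; apply/orP; left; apply/eqP; field.
  by rewrite gt_eqF.
have h3 : p%:R * ln r < p%:R * (r * chi2_const / 4).
  by rewrite ltr_pM2l//; apply: ln_le_linear => //; exact: ltW.
have cp := mulr_gt0 c0 pg.
move: h1 h2 h3 cp; set a := chi2_const * p%:R.
have -> : p%:R * (r * chi2_const / 4) = r * a / 4 by rewrite /a; ring.
move: (_ * W) (_ * s ^+ 2) (_ * ln r) => A B C; nra.
Qed.

(** Rounding [s] down to a grid point [u >= t0] changes it by a factor at most [1 + 1 / (n^2 t0)].
    Off the bad events the zero means lose at least [n hellinger_const t0^2 / 2] in the exponent,
    which by [big] exceeds all other terms. *)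
Lemma mix_prod_lt_large (y : n.-tuple R) s :
  (forall k, (k <= n ^ 2)%N -> ~ bad_grid k y) ->
  t <= s -> t0 <= s -> s <= 1 -> mix_prod n y s < mix_prod n y t.
Proof.
move=> bg ts t0s s1; have tg := t_gt0; have t0g := t0_gt0; have ng := n0.
have N0 : 0 < n%:R ^+ 2 :> R by exact: exprn_gt0.
have st0 : 0 <= s - t0 by lra.
have x0 : 0 <= (s - t0) * n%:R ^+ 2 by rewrite mulr_ge0 ?(ltW N0).
set k := Num.trunc ((s - t0) * n%:R ^+ 2).
have /andP[k1 k2] := truncn_itv x0; rewrite -/k in k1 k2.
have kn : (k <= n ^ 2)%N.
  rewrite -(@ler_nat R) natrX; apply: le_trans k1 _.
  by rewrite -[leRHS]mul1r ler_wpM2r ?(ltW N0)//; lra.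
have := bg k kn; move=> /negP; rewrite -ltNge => /ltW bk.
set u := t0 + k%:R / n%:R ^+ 2.
have us : u <= s by rewrite /u addrC -lerBrDr ler_pdivrMr.
have t0u : t0 <= u by rewrite /u lerDl divr_ge0 ?(ltW N0).
have su : s <= u + (n%:R ^+ 2)^-1.
  have : s - t0 < k.+1%:R / n%:R ^+ 2 by rewrite ltr_pdivlMr.
  by rewrite -natr1 mulrDl mul1r /u; lra.
have u0 : 0 < u by exact: lt_le_trans t0u.
set d := (n%:R ^+ 2 * t0)^-1.
have d0 : 0 <= d by rewrite invr_ge0 mulr_ge0 ?ltW.
have sud : s / u <= 1 + d.
  rewrite ler_pdivrMr// mulrDl mul1r; apply: le_trans su _; rewrite lerD2l.
  have -> : d * u = (n%:R ^+ 2)^-1 * (u / t0).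
    by rewrite /d; field; rewrite !gt_eqF.
  rewrite ler_peMr ?invr_ge0 ?(ltW N0)//.
  by rewrite ler_pdivlMr// mul1r.
apply: le_lt_trans (mix_prod_le_grid n S p y t s u _ d t_gt0 t_le ts u0 us sud CS d0 bk) _.
rewrite -[ltRHS]mulr1 ltr_pM2l ?mix_prod_gt0// expR_lt1.
have lnr : ln (s / t) <= L.
  apply: le_trans lnVt_le; rewrite ler_ln ?posrE ?divr_gt0 ?invr_gt0//; last by lra.
  by rewrite ler_pdivrMr// mulVf ?gt_eqF.
have h1 : p%:R * ln (s / t) <= p%:R * L by rewrite ler_wpM2l.
have -> : n%:R * d = (n%:R * t0)^-1 by rewrite /d; field; rewrite !gt_eqF.
have h0 : 0 <= hellinger_const * t0 ^+ 2 by rewrite mulr_ge0 ?sqr_ge0 ?(ltW hellinger_const_gt0).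
have h2 : n%:R * (hellinger_const * t0 ^+ 2) <= 2 * m * (hellinger_const * t0 ^+ 2).
  by rewrite ler_wpM2r.
have := big; lra.
Qed.

Variables (tauM : n.-tuple R -> R).
Hypotheses (mtauM : measurable_fun setT tauM) (mmle : forall y, is_mmle y (tauM y)).

Lemma mmle_probability_ge :
  ((1 - (expR (- (chi2_const * p%:R / 4)) +
     (n ^ 2).+1%:R * expR (- (n%:R * hellinger_const * t0 ^+ 2 / 4))))%:E <=
   normal_means theta [set y | (tauM y \in `[n%:R^-1, mmle_const * t])%R])%E.
Proof.
set G := [set y | _].
have mG : measurable G.
  rewrite (_ : G = tauM @^-1` `[n%:R^-1, mmle_const * t]); last by [].
  by rewrite -[X in measurable X]setTI; exact: mtauM.
set B := bad_score `|` \big[setU/set0]_(k < (n ^ 2).+1) bad_grid k.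
have mB : measurable (\big[setU/set0]_(k < (n ^ 2).+1) bad_grid k).
  by apply: bigsetU_measurable => k _; exact: measurable_bad_grid.
have GB : ~` G `<=` B.
  move=> y /= Gy; apply: contrapT => /not_orP[By1 By2]; apply: Gy.
  have bg k : (k <= n ^ 2)%N -> ~ bad_grid k y.
    move=> kn bk; apply: By2; rewrite -bigcup_mkord; exists k => //=.
  have [+ max] := mmle y; rewrite !in_itv/= => /andP[ge1 le1].
  rewrite /G /= in_itv/= ge1 leNgt; apply/negP => Kt.
  have tt : t <= tauM y.
    apply/ltW/(le_lt_trans _ Kt); rewrite ler_peMl ?(ltW t_gt0)//.
    by apply: le_trans mmle_const_ge2; lra.
  (* The rate is itself an admissible parameter, since [n t = p sqrt L >= 1]; the maximizer must do
     at least as well. *)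
  have tI : t \in `[n%:R^-1, 1].
    rewrite in_itv/= (ltW t_lt1) andbT -div1r ler_pdivrMr// mulrC ntE.
    by rewrite -[leLHS]mulr1 ler_pM// ler1n.
  have tM0 : 0 < tauM y by apply: lt_le_trans tt; exact: t_gt0.
  have := max _ tI; rewrite marginal_likelihood_le// leNgt => /negP; apply.
  have [s0|/ltW s0] := leP (tauM y) t0; first exact: mix_prod_lt_small.
  exact: mix_prod_lt_large.
rewrite -[G]setCK probability_setC; last exact: measurableC.
rewrite EFinB; apply: leeB => //.
apply: le_trans (le_measure _ _ _ GB) _; rewrite ?inE//.
- exact: measurableC.
- by apply: measurableU => //; exact: measurable_bad_score.
apply: le_trans (measureU2 _ _ _) _ => //; first exact: measurable_bad_score.
rewrite EFinD; apply: leeD; first exact: bad_score_le.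
apply: measure_bigsetU_le => k; first exact: measurable_bad_grid.
by rewrite ltnS; exact: bad_grid_le.
Qed.

End fixed_mean.
End mmle_probability_bound.

(** * Asymptotics *)

Section asymptotics.
Context {R : realType}.
Implicit Types (x A : R) (n p : nat).

Lemma expR_ge_expn x k : 0 <= x -> x ^+ k.+1 / (k.+1)`!%:R <= expR x.
Proof. by move=> x0; apply: le_trans (expR_ge1Dxn k x0); rewrite lerDr. Qed.

(** Since [p / n = exp (- L)], everything reduces to an exponential beating powers of [L], uniformly
    in [n] and [p]. *)
Lemma mmle_conditions : exists A : R, forall n p, (0 < p)%N -> (0 < n)%N ->
  let L := ln (n%:R / p%:R) in
  let t := tau_rate R n p in
  let t0 := chi2_const / (16 * Num.sqrt L) in
  A <= L ->
  [/\ 1 <= L, (p.*2 <= n)%N, t <= 1 / 2, 960 <= ln t^-1 & t0 <= 1] /\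
  (n%:R * t0)^-1 + 2 * t * n%:R + p%:R * L <
    n%:R * hellinger_const * t0 ^+ 2 / 2.
Proof.
move: (@chi2_const R) (@hellinger_const R) (@chi2_const_gt0 R) (@hellinger_const_gt0 R).
move=> c h c0 h0.
pose k := (16 / c + 3) * 512 / (h * c ^+ 2).
have hc : 0 < h * c ^+ 2 by rewrite mulr_gt0// exprn_gt0.
have c16 : 0 < 16 / c by rewrite divr_gt0.
have k0 : 0 < k by apply: divr_gt0; [lra | exact: hc].
(* The term 1920 gives [ln (1 / t) >= L / 2 >= 960], [c^2] gives [c <= sqrt L] for [t0 <= 1], and
   [6 k] gives [x L^2 k < 1] through [exp L >= L^3 / 6]. That last inequality is the final claim
   after division by [n]. *)
exists (1920 + c ^+ 2 + 6 * k) => n p p0 n0 L t t0 AL.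
have c20 := sqr_ge0 c.
have L1920 : 1920 <= L by lra.
have pR : 0 < p%:R :> R by rewrite ltr0n.
have nR : 0 < n%:R :> R by rewrite ltr0n.
have np0 : 0 < n%:R / p%:R :> R by rewrite divr_gt0.
have eL : expR L = n%:R / p%:R by rewrite lnK.
have q0 : 0 < Num.sqrt L by rewrite sqrtr_gt0; lra.
have q2 : Num.sqrt L ^+ 2 = L by rewrite sqr_sqrtr//; lra.
pose q := Num.sqrt L; rewrite -/q in q0 q2.
have tE : t = p%:R / n%:R * q by [].
have q1 : 1 <= q by nra.
have cq : c <= q by nra.
pose x := p%:R / n%:R : R.
have x0 : 0 < x by rewrite divr_gt0.
have xe : x * expR L = 1 by rewrite eL /x; field; rewrite !gt_eqF.
have e2 : expR L = expR (L / 2) ^+ 2 by rewrite -expRM_natl; congr expR; field.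
have eh : 1 + L / 2 <= expR (L / 2) by exact: expR_ge1Dx.
have qe : q <= expR (L / 2) by nra.
have t_gt0 : 0 < t by rewrite tE mulr_gt0.
have te : t * expR (L / 2) <= 1.
  have xE : 0 < x * expR (L / 2) by rewrite mulr_gt0 ?expR_gt0.
  have := ler_wpM2l (ltW xE) qe; move: xe; rewrite tE -/x e2; nra.
have ht : expR (L / 2) <= t^-1 by rewrite -[leRHS]div1r ler_pdivlMr// mulrC.
split; first split.
- lra.
- have : 2 <= n%:R / p%:R :> R by rewrite -eL e2; nra.
  by rewrite ler_pdivlMr// -natrM ler_nat mul2n.
- nra.
- have : L / 2 <= ln t^-1 by rewrite -[leLHS]expRK ler_ln ?posrE ?expR_gt0 ?invr_gt0.
  lra.
- by rewrite /t0 -/q ler_pdivrMr ?mulr_gt0//; lra.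
have t0_gt0 : 0 < t0 by rewrite /t0 divr_gt0// mulr_gt0.
have n1 : 1 <= n%:R :> R by rewrite ler1n.
have p1 : 1 <= p%:R :> R by rewrite ler1n.
rewrite -(ltr_pM2l (_ : 0 < n%:R^-1 :> R)) ?invr_gt0//.
have -> : n%:R^-1 * (n%:R * h * t0 ^+ 2 / 2) = h * c ^+ 2 / (512 * L).
  by rewrite /t0 -/q -q2; field; rewrite !gt_eqF.
have xL : x * (L ^+ 2) * k < 1.
  have : L ^+ 3 / 6 <= expR L.
    by have := @expR_ge_expn L 2; rewrite !factS fact0/=; apply; lra.
  have L0 : 0 < L by lra.
  have : 6 * k < L by lra.
  have : 0 < x * L ^+ 2 by rewrite mulr_gt0 ?exprn_gt0.
  rewrite -(ler_pM2l x0) xe => xL2 kL.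
  by rewrite (_ : x * (L ^+ 3 / 6) = x * L ^+ 2 * L / 6); [nra | field].
apply: (@le_lt_trans _ _ (x * L * (16 / c + 3))).
  have -> : n%:R^-1 * ((n%:R * t0)^-1 + 2 * t * n%:R + p%:R * L) =
      n%:R^-1 * n%:R^-1 * (16 * q / c) + 2 * (x * q) + x * L.
    by rewrite tE -/x /t0 -/q /x; field; rewrite !gt_eqF.
  have nx : n%:R^-1 <= x by rewrite /x ler_peMl ?invr_ge0 ?(ltW nR).
  have n1' : n%:R^-1 <= 1 :> R by rewrite invf_le1.
  have qL : q <= L by nra.
  have h1 : n%:R^-1 * n%:R^-1 * (16 * q / c) <= x * L * (16 / c).
    have -> : x * L * (16 / c) = x * 1 * (16 * L / c) by ring.
    rewrite ler_pM ?mulr_ge0 ?invr_ge0 ?(ltW nR) ?(ltW q0) ?(ltW c0)//.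
      by rewrite ler_pM ?invr_ge0 ?(ltW nR).
    by rewrite ler_pM2r ?invr_gt0// ler_pM2l.
  nra.
rewrite ltr_pdivlMr; last by lra.
have -> : x * L * (16 / c + 3) * (512 * L) = x * L ^+ 2 * k * (h * c ^+ 2).
  by rewrite /k; field; rewrite !gt_eqF.
by rewrite -[ltRHS]mul1r ltr_pM2r.
Qed.

(** As [L <= ln n <= 2 sqrt n], the exponent is at least [a sqrt n]; the sixth-order term of the
    exponential is then of order [n^3], against about [n^2] grid points. *)
Lemma grid_error_le : exists2 B : R, 0 <= B & forall n p, (0 < p)%N -> (0 < n)%N ->
  let L := ln (n%:R / p%:R) in
  let t0 := chi2_const / (16 * Num.sqrt L) in
  1 <= L ->
  (n ^ 2).+1%:R * expR (- (n%:R * hellinger_const * t0 ^+ 2 / 4)) <= B * n%:R^-1.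
Proof.
move: (@chi2_const R) (@hellinger_const R) (@chi2_const_gt0 R) (@hellinger_const_gt0 R).
move=> c h c0 h0.
pose a := h * c ^+ 2 / (16 * 128).
have hc : 0 < h * c ^+ 2 by rewrite mulr_gt0// exprn_gt0.
have a0 : 0 < a by apply: divr_gt0; [exact: hc | lra].
exists (2 * 720 / a ^+ 6); first by apply: divr_ge0; [lra | exact/exprn_ge0/ltW].
move=> n p p0 n0 L t0 L1.
have pR : 0 < p%:R :> R by rewrite ltr0n.
have nR : 0 < n%:R :> R by rewrite ltr0n.
have y0 : 0 < Num.sqrt n%:R :> R by rewrite sqrtr_gt0.
have y2 : Num.sqrt n%:R ^+ 2 = n%:R :> R by rewrite sqr_sqrtr// ltW.
move: (Num.sqrt _) y0 y2 => y y0 y2.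
have Ly : L <= 2 * y.
  apply: (@le_trans _ _ (ln n%:R)).
    by rewrite ler_ln ?posrE ?divr_gt0// ler_pdivrMr// ler_peMr ?(ltW nR)// ler1n.
  have -> : ln n%:R = 2 * ln y by rewrite -y2 lnXn// mulr_natl.
  by rewrite ler_pM2l//; exact/ltW/ln_sublinear.
have q0 : 0 < Num.sqrt L by rewrite sqrtr_gt0; lra.
have q2 : Num.sqrt L ^+ 2 = L by rewrite sqr_sqrtr//; lra.
pose q := Num.sqrt L; rewrite -/q in q0 q2.
have ay : a * y <= n%:R * h * t0 ^+ 2 / 4.
  have -> : n%:R * h * t0 ^+ 2 / 4 = n%:R * (h * c ^+ 2 / (8 * 128)) / L.
    by rewrite /t0 -/q -q2; field; rewrite !gt_eqF.
  rewrite ler_pdivlMr; last by lra.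
  rewrite -y2 /a.
  have : 0 < h * c ^+ 2 by rewrite mulr_gt0// exprn_gt0.
  move: (h * c ^+ 2) => b b0.
  have : b * y * L <= b * y * (2 * y) by rewrite ler_wpM2l// mulr_ge0 ?ltW.
  lra.
have e6 : (a * y) ^+ 6 / 720 <= expR (a * y).
  have ay0 : 0 <= a * y by rewrite mulr_ge0 ?ltW.
  by have := @expR_ge_expn (a * y) 5 ay0; rewrite !factS fact0/=.
apply: (@le_trans _ _ (2 * n%:R ^+ 2 * (720 / (a * y) ^+ 6))).
  rewrite ler_pM ?expR_ge0//.
    by rewrite -natrX -natrM ler_nat mul2n -addnn -addn1 leq_add2l expn_gt0 n0.
  have z0 : 0 < (a * y) ^+ 6 / 720.
    by apply: divr_gt0; [exact/exprn_gt0/mulr_gt0 | lra].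
  rewrite -[leRHS]invf_div expRN lef_pV2 ?posrE ?expR_gt0 ?z0//.
  by apply: le_trans e6 _; rewrite ler_expR.
rewrite exprMn -y2 le_eqVlt; apply/orP; left; apply/eqP; field.
by rewrite !gt_eqF.
Qed.

Lemma expRN_le_inv (x : R) : 0 < x -> expR (- x) <= x^-1.
Proof.
move=> x0; rewrite expRN lef_pV2 ?posrE ?expR_gt0//.
by apply: le_trans (expR_ge1Dx x); rewrite lerDr.
Qed.

End asymptotics.

Theorem theorem3p1 (R : realType) (p : nat -> nat)
    (tauM : forall n : nat, n.-tuple R -> R)
    (p_gt0 : forall n : nat, (0 < p n)%N)
    (p_infty : p n @[n --> \oo] --> \oo)
    (p_small : ((p n)%:R / n%:R : R) @[n --> \oo] --> (0 : R))
    (tauM_measurable : forall n : nat, measurable_fun setT (tauM n))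
    (tauM_mmle : forall (n : nat) (y : n.-tuple R), is_mmle y (tauM n y)) :
  exists C : R, 0 < C /\
    ereal_inf [set normal_means theta0
                 [set y | tauM n y \in `[n%:R^-1, C * tau_rate R n (p n)]]
              | theta0 in nearly_black R n (p n)] @[n --> \oo] --> 1%E.
Proof.
exists mmle_const; split.
  exact: lt_le_trans mmle_const_ge2.
have [A condA] := @mmle_conditions R.
have [B B0 errB] := @grid_error_le R.
(* The lower bound combines [exp (- x) <= 1 / x] for the score event, which needs [p n] to tend to
   infinity, with the grid error. *)
pose v (n : nat) : R := 1 - (4 / chi2_const * (p n)%:R^-1 + B * n%:R^-1).
apply: (@squeeze_cvge _ _ _ _ (EFin \o v) _ (cst 1%E)); last 2 first.
- apply: cvg_EFin; first exact: nearW.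
  have inv_cvg (u : nat -> nat) : u n @[n --> \oo] --> \oo ->
      ((u n)%:R^-1 : R) @[n --> \oo] --> (0 : R).
    move=> /(@cvgrnyP R) uoo; apply/(@gtr0_cvgV0 _ _ _ _ (fun n => (u n)%:R)) => //.
    by move/cvgryPgt : uoo; apply.
  rewrite [X in _ --> X](_ : _ = 1 - (4 / chi2_const * 0 + B * 0)); last by rewrite !mulr0 addr0 subr0.
  apply: cvgB; first exact: cvg_cst.
  apply: cvgD; apply: cvgM; try exact: cvg_cst.
  + exact: inv_cvg.
  + exact: (inv_cvg id).
- exact: cvg_cst.
near=> n.
have n0 : (0 < n)%N by near: n; exists 1%N.
have c0 := @chi2_const_gt0 R.
have nR : 0 < n%:R :> R by rewrite ltr0n.
have pR : 0 < (p n)%:R :> R by rewrite ltr0n.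
have AL : A <= ln (n%:R / (p n)%:R).
  have : (p n)%:R / n%:R < expR (- A) :> R.
    by near: n; apply: (cvgr_lt _ p_small); exact: expR_gt0.
  rewrite expRN -[ltLHS]invrK invf_div ltf_pV2 ?posrE ?expR_gt0 ?divr_gt0// => /ltW h.
  by rewrite -[leLHS]expRK ler_ln ?posrE ?expR_gt0 ?divr_gt0.
have [[L1 pn t_le t_small t01] big] := condA n (p n) (p_gt0 n) n0 AL.
apply/andP; split.
  apply: le_ereal_inf_tmp => _ [theta theta_black <-].
  apply: le_trans (mmle_probability_ge _ _ _ _ _ (p_gt0 n) pn erefl erefl L1 t_le t_small
     erefl t01 big theta theta_black (tauM n) (tauM_measurable n) (tauM_mmle n)).
  rewrite lee_fin lerD2l lerN2 lerD//.
    apply: le_trans (expRN_le_inv _ _) _; first by rewrite divr_gt0// mulr_gt0.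
    by rewrite le_eqVlt; apply/orP; left; apply/eqP; field; rewrite !gt_eqF.
  exact: errB.
(* For the upper bound, the zero vector is nearly black and its probability is at most 1. *)
apply: ge_ereal_inf.
exists (normal_means [tuple 0 | i < n] [set y | tauM n y \in `[n%:R^-1, mmle_const * tau_rate R n (p n)]]).
  exists [tuple 0 | i < n] => //.
  rewrite /nearly_black /= eq_card0// => i.
  by rewrite !inE tnth_mktuple eqxx.
apply: probability_le1.
rewrite (_ : [set y | _] = tauM n @^-1` `[n%:R^-1, mmle_const * tau_rate R n (p n)])//.
by rewrite -[X in measurable X]setTI; exact: tauM_measurable.
Unshelve. all: by end_near.
Qed.
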